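(* Let $\Bbbk$ be a field of characteristic $p=3$, and let $r=5$, $m=2$, $n=1$. (i) $\dim_{\Bbbk}\mathrm{End}_{GL(2|1)}(V_{2|1}^{\otimes 5})=120$ and $\dim_{\Bbbk}\mathrm{im}\,\Phi^{(5)}_{2|1}=119$. (ii) The morphism $\widetilde\Phi^{(5)}_{2|1}:\Sigma^{(5)}_{2|1}\to\mathrm{End}_{GL(2|1)}(V_{2|1}^{\otimes5})$ is an isomorphism. (iii) $\Sigma^{(5)}_{2|1,\mathbb Z}$ is the subring of $\mathbb Z[\tfrac13]S_5$ generated by $S_5$ and $\tfrac13\sum_{\sigma\in S_5}\mathrm{sign}(\sigma)\sigma$.
   Context: For $K\in\{\Bbbk,\mathbb Z\}$ let $V_{2|1,K}=K^{2|1}$ be the free super module with even part of rank $2$ and odd part of rank $1$; $V_{2|1}=V_{2|1,\Bbbk}$. $GL(2|1)$ is the affine group superscheme over $\Bbbk$ sending a supercommutative $\Bbbk$-superalgebra $R$ to the group of parity-preserving $R$-linear automorphisms of $V_{2|1}\otimes R$; it acts diagonally on $V_{2|1}^{\otimes 5}$, and $\mathrm{End}_{GL(2|1)}(V_{2|1}^{\otimes 5})$ is the algebra of (parity-preserving) $\Bbbk$-linear endomorphisms commuting with this action. $S_5$ acts on $V_{2|1,K}^{\otimes 5}$ by $$\sigma(v_1\otimes\cdots\otimes v_5)=(-1)^{\langle\sigma;v_1,\dots,v_5\rangle}\,v_{\sigma^{-1}1}\otimes\cdots\otimes v_{\sigma^{-1}5}$$ for homogeneous $v_i$, where $\langle\sigma;v_1,\dots,v_5\rangle=\#\{1\le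 k<l\le 5\mid \sigma k>\sigma l,\ v_k,v_l \text{ odd}\}$. Over $\Bbbk$ this gives the algebra morphism $\Phi^{(5)}_{2|1}:\Bbbk S_5\to\mathrm{End}_{GL(2|1)}(V_{2|1}^{\otimes5})$; over $\mathbb Z$ it gives a ring homomorphism $f:\mathbb ZS_5\to\mathrm{End}(V_{2|1,\mathbb Z}^{\otimes5})$. Let $\widetilde f=\mathbb Z[\frac13]\otimes f:\mathbb Z[\frac13]S_5\to\mathbb Z[\frac13]\otimes\mathrm{End}(V_{2|1,\mathbb Z}^{\otimes 5})$, define $\Sigma^{(5)}_{2|1,\mathbb Z}:=\mathrm{im}(\widetilde f)\cap\mathrm{End}(V_{2|1,\mathbb Z}^{\otimes5})$ (a subring), and $\Sigma^{(5)}_{2|1}:=\Bbbk\otimes_{\mathbb Z}\Sigma^{(5)}_{2|1,\mathbb Z}$. The inclusion $\Sigma^{(5)}_{2|1,\mathbb Z}\subseteq\mathrm{End}(V_{2|1,\mathbb Z}^{\otimes 5})$ induces the (injective) algebra morphism $\widetilde\Phi^{(5)}_{2|1}:\Sigma^{(5)}_{2|1}\to\mathrm{End}_{GL(2|1)}(V_{2|1}^{\otimes5})$. In (iii), the homomorphism $f$, hence $\widetilde f$, is injective, and $\Sigma^{(5)}_{2|1,\mathbb Z}$ is regarded as a subring of $\mathbb Z[\frac13]S_5$ via $\widetilde f$. *)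

(* Defs.v *)
From HB Require Import structures.
From mathcomp Require Import all_boot all_order all_algebra all_fingroup.
From mathcomp Require Import boolp.

Set Implicit Arguments.
Unset Strict Implicit.
Unset Printing Implicit Defensive.

Import GRing.Theory.
Local Open Scope ring_scope.

(* The localization Z[1/3] is realized as a subring of the rationals. *)
Definition Zthird_pred : {pred rat} :=
  fun x => `[< exists n : nat, x * 3%:R ^+ n \is a Num.int >].

Lemma Zthird_subring : subring_closed Zthird_pred.
Proof.
split.
- by apply/asboolP; exists 0%N; rewrite expr0 mulr1 rpred1.
- move=> x y /asboolP[a xa] /asboolP[b yb]; apply/asboolP; exists (a + b)%N.
  rewrite mulrBl exprD mulrA [_ ^+ a * _]mulrC mulrA rpredB //.
    by rewrite rpredM ?rpredX ?rpred_nat.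
  by rewrite rpredM ?rpredX ?rpred_nat.
- move=> x y /asboolP[a xa] /asboolP[b yb]; apply/asboolP; exists (a + b)%N.
  by rewrite exprD mulrACA rpredM.
Qed.

HB.instance Definition _ := GRing.isSubringClosed.Build rat Zthird_pred
  Zthird_subring.

Record Zthird := MkZthird { Zthird_val : rat; _ : Zthird_val \in Zthird_pred }.

HB.instance Definition _ := [isSub for Zthird_val].
HB.instance Definition _ := [Choice of Zthird by <:].
HB.instance Definition _ := [SubChoice_isSubComNzRing of Zthird by <:].

Lemma third_subproof : (3%:R^-1 : rat) \in Zthird_pred.
Proof. by apply/asboolP; exists 1%N; rewrite expr1 mulVf // rpred1. Qed.

Definition third : Zthird := MkZthird third_subproof.

(* The group algebra K[S_r].  The product of S_r used here is composition of
   functions, s o t = (t * s)%g, so that S_r acts on tensors from the left. *)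
Section GroupAlgebra.
Variables (K : comNzRingType) (r : nat).

Definition grpalg := {ffun 'S_r -> K}.

HB.instance Definition _ := GRing.Zmodule.on grpalg.

Definition grp (s : 'S_r) : grpalg := [ffun t => (t == s)%:R].

Definition grpalg_mul (a b : grpalg) : grpalg :=
  [ffun u => \sum_(s : 'S_r) \sum_(t : 'S_r | (t * s)%g == u) a s * b t].

Lemma grpalg_mulE a b u :
  grpalg_mul a b u = \sum_(s : 'S_r) a s * b (u * s^-1)%g.
Proof.
rewrite ffunE; apply: eq_bigr => s _.
by rewrite (big_pred1 (u * s^-1)%g) // => t /=; rewrite -(inj_eq (mulIg s^-1)%g) mulgK.
Qed.

Lemma grpalg_mulA : associative grpalg_mul.
Proof.
move=> a b c; apply/ffunP=> u; rewrite !grpalg_mulE.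
under eq_bigr do rewrite grpalg_mulE mulr_sumr.
under [RHS]eq_bigr do rewrite grpalg_mulE mulr_suml.
rewrite [RHS]exchange_big /=; apply: eq_bigr => s _.
rewrite [RHS](reindex_inj (mulIg s)) /=; apply: eq_bigr => t _.
by rewrite mulgK invMg !mulgA mulrA.
Qed.

Lemma grpalg_mul1l : left_id (grp 1) grpalg_mul.
Proof.
move=> a; apply/ffunP=> u; rewrite grpalg_mulE (bigD1 1%g) //= big1 => [|s].
  by rewrite ffunE eqxx mul1r invg1 mulg1 addr0.
by rewrite ffunE => /negPf->; rewrite mul0r.
Qed.

Lemma grpalg_mul1r : right_id (grp 1) grpalg_mul.
Proof.
move=> a; apply/ffunP=> u; rewrite grpalg_mulE (bigD1 u) //= big1 => [|s].
  by rewrite ffunE mulgV eqxx mulr1 addr0.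
rewrite ffunE => /negPf su; rewrite -(inj_eq (mulIg s)) mulgKV mul1g eq_sym su.
by rewrite mulr0.
Qed.

Lemma grpalg_mulDl : left_distributive grpalg_mul +%R.
Proof.
move=> a b c; apply/ffunP=> u.
rewrite [RHS]ffunE !grpalg_mulE -big_split /=.
by apply: eq_bigr => s _; rewrite ffunE mulrDl.
Qed.

Lemma grpalg_mulDr : right_distributive grpalg_mul +%R.
Proof.
move=> a b c; apply/ffunP=> u.
rewrite [RHS]ffunE !grpalg_mulE -big_split /=.
by apply: eq_bigr => s _; rewrite ffunE mulrDr.
Qed.

HB.instance Definition _ := GRing.Zmodule_isPzRing.Build grpalg
  grpalg_mulA grpalg_mul1l grpalg_mul1r grpalg_mulDl grpalg_mulDr.

End GroupAlgebra.

Definition subring_gen (R : pzRingType) (X : R -> Prop) (x : R) : Prop :=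
  forall S : {pred R}, subring_closed S -> (forall y, X y -> y \in S) -> x \in S.

(* K^(m|n) has basis e_i (i : 'I_(m + n)), with e_i odd iff m <= i; its r-th
   tensor power has basis e_I = e_(I 0) (x) ... (x) e_(I (r-1)), indexed by
   the functions I.  Endomorphisms of the tensor power are written as matrices
   in this basis (enumerated by [enum_rank]), acting on columns. *)
Section SuperTensor.
Variables m n r : nat.

Definition odd_ix (i : 'I_(m + n)) : bool := (m <= i)%N.

Definition tix := {ffun 'I_r -> 'I_(m + n)}.

Definition odd_tix (I : tix) : bool := \big[addb/false]_(k < r) odd_ix (I k).

Definition tmx (K : Type) := 'M[K]_(#|{: tix}|).

Definition tmx_of (K : Type) (F : tix -> tix -> K) : tmx K :=
  \matrix_(i, j) F (enum_val i) (enum_val j).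

Definition tentry (K : Type) (A : tmx K) (I J : tix) : K :=
  A (enum_rank I) (enum_rank J).

Lemma tmx_ofE (K : Type) (F : tix -> tix -> K) I J :
  tentry (tmx_of F) I J = F I J.
Proof. by rewrite /tentry mxE !enum_rankK. Qed.

Lemma tmxP (K : Type) (A B : tmx K) : tentry A =2 tentry B -> A = B.
Proof.
move=> AB; apply/matrixP => i j.
by have := AB (enum_val i) (enum_val j); rewrite /tentry !enum_valK.
Qed.

(* <s; e_(J 0), ..., e_(J (r-1))> *)
Definition sgn_exp (s : 'S_r) (J : tix) : nat :=
  #|[set u : 'I_r * 'I_r | [&& (u.1 < u.2)%N, (s u.2 < s u.1)%N,
                               odd_ix (J u.1) & odd_ix (J u.2)]]|.

Definition perm_tix (s : 'S_r) (J : tix) : tix := [ffun k => J (s^-1%g k)].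

Definition perm_act (K : pzRingType) (s : 'S_r) : tmx K :=
  tmx_of (fun I J => if I == perm_tix s J then (-1) ^+ sgn_exp s J else 0).

(* The algebra morphism K[S_r] -> End(V^(x)r): this is f for K = int, f~ for
   K = Zthird and Phi for K a field. *)
Definition sact (K : comNzRingType) (a : grpalg K r) : tmx K :=
  \sum_(s : 'S_r) a s *: perm_act K s.

Lemma perm_tixM s t J : perm_tix (t * s)%g J = perm_tix s (perm_tix t J).
Proof. by apply/ffunP=> k; rewrite !ffunE invMg permM. Qed.

Let flip (s : 'S_r) (u : 'I_r * 'I_r) := (u.1 < u.2)%N (+) (s u.1 < s u.2)%N.
Let oddp (J : tix) (u : 'I_r * 'I_r) := odd_ix (J u.1) && odd_ix (J u.2).

Lemma odd_sgn_exp s J :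
  odd (sgn_exp s J) =
  \big[addb/false]_(u : 'I_r * 'I_r | (u.1 < u.2)%N) (flip s u && oddp J u).
Proof.
rewrite /sgn_exp -sum1_card (big_morph odd oddD (erefl _ : odd 0 = false)).
rewrite -big_mkcondr /= [in RHS]big_mkcond [in LHS]big_mkcond /=.
apply: eq_bigr => -[k l] _; rewrite inE /flip /oddp /=.
case: ltngtP => //= kl; rewrite ltnNge leq_eqVlt.
have -> : ((s k : nat) == s l) = false.
  by apply/negP => /eqP/val_inj/perm_inj E; rewrite E ltnn in kl.
by case: (s k < s l)%N; case: (odd_ix _); case: (odd_ix _).
Qed.

Let srt (u : 'I_r * 'I_r) := if (u.1 < u.2)%N then u else (u.2, u.1).

Lemma big_pair_perm (t : 'S_r) (h : 'I_r * 'I_r -> bool) :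
    (forall k l, h (k, l) = h (l, k)) ->
  \big[addb/false]_(u : 'I_r * 'I_r | (u.1 < u.2)%N) h u =
  \big[addb/false]_(u : 'I_r * 'I_r | (u.1 < u.2)%N) h (t u.1, t u.2).
Proof.
move=> hC.
pose F (t : 'S_r) (u : 'I_r * 'I_r) := srt (t u.1, t u.2).
have FK (q : 'S_r) (u : 'I_r * 'I_r) : (u.1 < u.2)%N -> F (q^-1)%g (F q u) = u.
  case: u => k l /= kl; rewrite /F /srt /=.
  case: (ltnP (q k) (q l)) => _ /=; rewrite !permK ?kl //.
  by rewrite ltnNge (ltnW kl).
have Flt (q : 'S_r) (u : 'I_r * 'I_r) : (u.1 < u.2)%N -> ((F q u).1 < (F q u).2)%N.
  case: u => k l /= kl; rewrite /F /srt /=; case: ifP => //= /negbT.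
  rewrite -leqNgt leq_eqVlt => /orP[/eqP/val_inj/perm_inj E|//].
  by rewrite E ltnn in kl.
rewrite (reindex_onto (F t) (F t^-1)%g) => [|u /(FK t^-1%g)]; last first.
  by rewrite invgK.
apply: eq_big => [u|u _]; last by rewrite /F /srt /=; case: ifP.
apply/andP/idP => [[lt /eqP <-]|ult]; last by rewrite FK ?Flt.
exact: Flt.
Qed.

Lemma odd_sgn_expM s t J :
  odd (sgn_exp (t * s)%g J) =
  odd (sgn_exp s (perm_tix t J)) (+) odd (sgn_exp t J).
Proof.
have flipC (q : 'S_r) k l : k != l -> flip q (k, l) = flip q (l, k).
  have ltC (a b : 'I_r) : a != b -> (b < a)%N = ~~ (a < b)%N.
    case: (ltngtP a b) => // /val_inj E; by rewrite E eqxx.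
  move=> kl; rewrite /flip /= (ltC k l) // (ltC (q k) (q l)) ?(inj_eq perm_inj) //.
  by rewrite addbN addNb negbK.
rewrite !odd_sgn_exp.
pose h (u : 'I_r * 'I_r) :=
  (u.1 != u.2) && (flip s u && oddp (perm_tix t J) u).
have hC k l : h (k, l) = h (l, k).
  rewrite /h /= eq_sym /oddp /= [odd_ix _ && _]andbC.
  by case: eqVneq => //= /flipC ->.
rewrite [X in _ = X (+) _](eq_bigr h) => [|u ult]; last first.
  by rewrite /h neq_ltn ult.
rewrite (big_pair_perm t hC) -big_split /=; apply: eq_bigr => -[k l] /= kl.
rewrite /h /= (inj_eq perm_inj) neq_ltn kl /= /oddp /= !ffunE !permK.
rewrite /flip /= kl !permM.
by do 2!case: (odd_ix _) => //; case: (t k < t l)%N; case: (s _ < s _)%N.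
Qed.

Section PermAct.
Variable K : comNzRingType.

Lemma tentry_mul (A B : tmx K) I J :
  tentry (A *m B) I J = \sum_(L : tix) tentry A I L * tentry B L J.
Proof.
rewrite /tentry mxE (reindex _ (onW_bij _ (@enum_rank_bij tix))) /=.
by apply: eq_bigr.
Qed.

Lemma perm_actM s t : perm_act K (t * s)%g = perm_act K s *m perm_act K t.
Proof.
apply: tmxP => I J; rewrite tentry_mul (bigD1 (perm_tix t J)) //= big1 => [|L].
  rewrite addr0 !tmx_ofE eqxx perm_tixM; case: eqP => _; last by rewrite mul0r.
  by rewrite -signr_odd odd_sgn_expM signr_addb !signr_odd.
by rewrite !tmx_ofE => /negPf->; rewrite mulr0.
Qed.

Lemma perm_act1 : perm_act K 1%g = 1%:M.
Proof.
apply: tmxP => I J; rewrite tmx_ofE /tentry mxE (inj_eq enum_rank_inj).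
have -> : perm_tix 1 J = J by apply/ffunP=> k; rewrite ffunE invg1 perm1.
case: eqP => // _; rewrite /sgn_exp (_ : [set u | _] = set0) ?cards0 //.
apply/setP=> -[k l]; rewrite !inE /= !perm1.
by apply/negP=> /and4P[kl lk _ _]; move: (ltn_trans kl lk); rewrite ltnn.
Qed.

Lemma sact_is_zmod_morphism : zmod_morphism (@sact K).
Proof.
move=> a b; rewrite /sact -sumrB; apply: eq_bigr => s _.
by rewrite !ffunE scalerBl.
Qed.

HB.instance Definition _ :=
  GRing.isZmodMorphism.Build (grpalg K r) (tmx K) (@sact K)
    sact_is_zmod_morphism.

Lemma sact_is_monoid_morphism : monoid_morphism (@sact K).
Proof.
split.
  rewrite /sact (bigD1 1%g) //= big1 => [|s /negPf s1].
    by rewrite ffunE eqxx scale1r addr0 perm_act1.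
  by rewrite ffunE s1 scale0r.
move=> a b; rewrite /sact.
under eq_bigr do rewrite grpalg_mulE scaler_suml.
rewrite exchange_big /= -[RHS]/(_ *m _) mulmx_suml; apply: eq_bigr => s _.
rewrite (reindex_inj (mulIg s)) /= mulmx_sumr; apply: eq_bigr => t _.
by rewrite mulgK perm_actM -scalemxAl -scalemxAr scalerA.
Qed.

HB.instance Definition _ :=
  GRing.isMonoidMorphism.Build (grpalg K r) (tmx K) (@sact K)
    sact_is_monoid_morphism.

End PermAct.

End SuperTensor.

(* The tensor product k (x)_Z M: formal sums of pure tensors, two of them being
   identified when every biadditive map takes the same value on them. *)
Section ScalarExtension.
Local Open Scope quotient_scope.
Variables (k : comNzRingType) (M : zmodType).

Definition biadditive (W : zmodType) (b : k -> M -> W) : Prop :=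
  (forall x, {morph b^~ x : a c / a + c}) /\ (forall a, {morph b a : x y / x + y}).

Definition fsum (W : zmodType) (b : k -> M -> W) (s : seq (k * M)) : W :=
  \sum_(u <- s) b u.1 u.2.

Definition fsum_eq (s t : seq (k * M)) : bool :=
  `[< forall (W : zmodType) (b : k -> M -> W),
        biadditive b -> fsum b s = fsum b t >].

Lemma fsum_eq_refl : reflexive fsum_eq.
Proof. by move=> s; apply/asboolP. Qed.

Lemma fsum_eq_sym : symmetric fsum_eq.
Proof.
by move=> s t; apply/asboolP/asboolP => st W b /st ->.
Qed.

Lemma fsum_eq_trans : transitive fsum_eq.
Proof.
move=> t s u /asboolP st /asboolP tu; apply/asboolP => W b bb.
by rewrite (st _ _ bb) (tu _ _ bb).
Qed.

Canonical fsum_eq_equiv :=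
  EquivRel fsum_eq fsum_eq_refl fsum_eq_sym fsum_eq_trans.

Definition tensZ := {eq_quot fsum_eq_equiv}.

HB.instance Definition _ := Choice.on tensZ.

Definition tens_of (s : seq (k * M)) : tensZ := \pi_{eq_quot fsum_eq_equiv} s.

Definition pure (a : k) (x : M) : tensZ := tens_of [:: (a, x)].

Definition tens_repr (x : tensZ) : seq (k * M) :=
  @generic_quotient.repr _ {eq_quot fsum_eq_equiv} x.

Lemma tens_reprK : cancel tens_repr tens_of.
Proof. exact: reprK. Qed.

Definition tens_lift (W : zmodType) (b : k -> M -> W) (x : tensZ) : W :=
  fsum b (tens_repr x).

Lemma tens_liftE (W : zmodType) (b : k -> M -> W) s :
  biadditive b -> tens_lift b (tens_of s) = fsum b s.
Proof.
move=> bb; rewrite /tens_lift /tens_of.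
have /eqquotP/asboolP : (generic_quotient.repr (\pi_{eq_quot fsum_eq_equiv} s) = s
  %[mod {eq_quot fsum_eq_equiv}]) by rewrite reprK.
exact.
Qed.

Lemma tensZP (x y : tensZ) :
  (forall (W : zmodType) (b : k -> M -> W),
     biadditive b -> tens_lift b x = tens_lift b y) -> x = y.
Proof.
move=> xy; rewrite -(tens_reprK x) -(tens_reprK y).
by apply/eqquotP/asboolP => W b bb; apply: xy.
Qed.

Definition tens_zero : tensZ := tens_of [::].
Definition tens_add (x y : tensZ) : tensZ := tens_of (tens_repr x ++ tens_repr y).
Definition tens_scale (c : k) (x : tensZ) : tensZ :=
  tens_of [seq (c * u.1, u.2) | u <- tens_repr x].
Definition tens_opp (x : tensZ) : tensZ := tens_scale (-1) x.

Lemma biadditive_scale (W : zmodType) (b : k -> M -> W) c :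
  biadditive b -> biadditive (fun a x => b (c * a) x).
Proof.
by case=> bl br; split=> [x a a' | a x y]; rewrite ?mulrDr ?bl ?br.
Qed.

Section Lift.
Variables (W : zmodType) (b : k -> M -> W).
Hypothesis bb : biadditive b.

Lemma lift_zero : tens_lift b tens_zero = 0.
Proof. by rewrite tens_liftE // /fsum big_nil. Qed.

Lemma lift_add x y : tens_lift b (tens_add x y) = tens_lift b x + tens_lift b y.
Proof. by rewrite tens_liftE // /fsum big_cat. Qed.

Lemma lift_scale c x :
  tens_lift b (tens_scale c x) = tens_lift (fun a m => b (c * a) m) x.
Proof. by rewrite tens_liftE // /fsum big_map. Qed.

Lemma biadd0l x : b 0 x = 0.
Proof. by apply: (addIr (b 0 x)); rewrite -bb.1 !add0r. Qed.

Lemma biadd0r a : b a 0 = 0.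
Proof. by apply: (addIr (b a 0)); rewrite -bb.2 !add0r. Qed.

Lemma biaddNl a x : b (- a) x = - b a x.
Proof. by apply/eqP; rewrite -addr_eq0 -bb.1 addNr biadd0l. Qed.

Lemma lift_opp x : tens_lift b (tens_opp x) = - tens_lift b x.
Proof.
rewrite lift_scale /tens_lift /fsum -sumrN; apply: eq_bigr => u _.
by rewrite mulN1r biaddNl.
Qed.

Lemma lift_pure a x : tens_lift b (pure a x) = b a x.
Proof. by rewrite tens_liftE // /fsum big_seq1. Qed.

End Lift.

Lemma tens_addA : associative tens_add.
Proof. by move=> x y z; apply: tensZP => W b bb; rewrite !lift_add // addrA. Qed.

Lemma tens_addC : commutative tens_add.
Proof. by move=> x y; apply: tensZP => W b bb; rewrite !lift_add // addrC. Qed.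

Lemma tens_add0 : left_id tens_zero tens_add.
Proof.
by move=> x; apply: tensZP => W b bb; rewrite lift_add // lift_zero // add0r.
Qed.

Lemma tens_addN : left_inverse tens_zero tens_opp tens_add.
Proof.
move=> x; apply: tensZP => W b bb.
by rewrite lift_add // lift_opp // lift_zero // addNr.
Qed.

HB.instance Definition _ :=
  GRing.isZmodule.Build tensZ tens_addA tens_addC tens_add0 tens_addN.

Lemma tens_lift0 (W : zmodType) (b : k -> M -> W) : biadditive b -> tens_lift b 0 = 0.
Proof. exact: lift_zero. Qed.

Lemma tens_liftD (W : zmodType) (b : k -> M -> W) (x y : tensZ) :
  biadditive b -> tens_lift b (x + y) = tens_lift b x + tens_lift b y.
Proof. by move=> bb; apply: lift_add. Qed.

Lemma tens_liftN (W : zmodType) (b : k -> M -> W) (x : tensZ) :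
  biadditive b -> tens_lift b (- x) = - tens_lift b x.
Proof. by move=> bb; apply: lift_opp. Qed.

Lemma tens_scaleA c d x : tens_scale c (tens_scale d x) = tens_scale (c * d) x.
Proof.
apply: tensZP => W b bb; rewrite !lift_scale //; last exact: biadditive_scale.
by congr tens_lift; apply/funext => a; apply/funext => m; rewrite mulrA.
Qed.

Lemma tens_scale1 : left_id 1 tens_scale.
Proof.
move=> x; apply: tensZP => W b bb; rewrite lift_scale //.
by congr tens_lift; apply/funext => a; rewrite mul1r.
Qed.

Lemma tens_scaleDr : right_distributive tens_scale +%R.
Proof.
move=> c x y; apply: tensZP => W b bb.
have bc := biadditive_scale c bb.
by rewrite lift_scale // !tens_liftD // !lift_scale.
Qed.

Lemma tens_scaleDl x : {morph tens_scale^~ x : c d / c + d}.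
Proof.
move=> c d; apply: tensZP => W b bb.
rewrite tens_liftD // !lift_scale // /tens_lift /fsum -big_split /=.
by apply: eq_bigr => u _; rewrite mulrDl bb.1.
Qed.

HB.instance Definition _ := GRing.Zmodule_isLmodule.Build k tensZ
  tens_scaleA tens_scale1 tens_scaleDr tens_scaleDl.

Lemma tens_liftZ (W : zmodType) (b : k -> M -> W) c (x : tensZ) : biadditive b ->
  tens_lift b (c *: x) = tens_lift (fun a m => b (c * a) m) x.
Proof. by move=> bb; apply: lift_scale. Qed.

End ScalarExtension.

(* k (x)_Z A is a ring when A is, with (a (x) x) (b (x) y) = ab (x) xy. *)
Section ScalarExtensionRing.
Variables (k : comNzRingType) (A : pzRingType).
Local Notation T := (tensZ k A).

Definition tens_mul (x y : T) : T :=
  tens_of [seq (u.1 * v.1, u.2 * v.2) | u <- tens_repr x, v <- tens_repr y].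

Lemma tens_lift_mul (W : zmodType) (b : k -> A -> W) (x y : T) : biadditive b ->
  tens_lift b (tens_mul x y) =
  tens_lift (fun a m => tens_lift (fun c p => b (a * c) (m * p)) y) x.
Proof. by move=> bb; rewrite tens_liftE // /fsum big_allpairs_dep. Qed.

Lemma tens_lift_exch (W : zmodType) (b : k -> A -> k -> A -> W) (x y : T) :
  tens_lift (fun a m => tens_lift (fun c p => b a m c p) y) x =
  tens_lift (fun c p => tens_lift (fun a m => b a m c p) x) y.
Proof. by rewrite /tens_lift /fsum exchange_big. Qed.

Lemma biadditive_mulr (W : zmodType) (b : k -> A -> W) a m :
  biadditive b -> biadditive (fun c p => b (a * c) (m * p)).
Proof. by case=> bl br; split=> [? ? ?|? ? ?] /=; rewrite mulrDr ?bl ?br. Qed.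

Lemma biadditive_mull (W : zmodType) (b : k -> A -> W) c p :
  biadditive b -> biadditive (fun a m => b (a * c) (m * p)).
Proof. by case=> bl br; split=> [? ? ?|? ? ?] /=; rewrite mulrDl ?bl ?br. Qed.

Lemma biadditive_lift (W : zmodType) (b : k -> A -> k -> A -> W) (y : T) :
  (forall c p, biadditive (fun a m => b a m c p)) ->
  biadditive (fun a m => tens_lift (b a m) y).
Proof.
move=> bb; split=> [m a a' | a m m']; rewrite /tens_lift /fsum -big_split /=;
  by apply: eq_bigr => u _; case: (bb u.1 u.2) => bl br; rewrite ?bl ?br.
Qed.

Lemma tens_mulA : associative tens_mul.
Proof.
move=> x y z; apply: tensZP => W b bb.
have bmul := biadditive_mulr _ _ bb.
rewrite !tens_lift_mul //; last first.
  by apply: biadditive_lift => c p; apply: biadditive_mull.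
congr tens_lift; apply/funext => a; apply/funext => m.
rewrite tens_lift_mul //; congr tens_lift.
apply/funext => c; apply/funext => p; congr tens_lift.
by apply/funext => d; apply/funext => q; rewrite !mulrA.
Qed.

Lemma tens_mul1l : left_id (pure 1 1) tens_mul.
Proof.
move=> x; apply: tensZP => W b bb; rewrite tens_lift_mul // lift_pure.
  by congr tens_lift; apply/funext => a; apply/funext => m; rewrite !mul1r.
by apply: biadditive_lift => c p; apply: biadditive_mull.
Qed.

Lemma tens_mul1r : right_id (pure 1 1) tens_mul.
Proof.
move=> x; apply: tensZP => W b bb; rewrite tens_lift_mul //.
congr tens_lift; apply/funext => a; apply/funext => m.
by rewrite lift_pure ?mulr1 //; apply: biadditive_mulr.
Qed.

Lemma tens_mulDl : left_distributive tens_mul +%R.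
Proof.
move=> x y z; apply: tensZP => W b bb.
have bz : biadditive (fun a m => tens_lift (fun c p => b (a * c) (m * p)) z).
  by apply: biadditive_lift => c p; apply: biadditive_mull.
by rewrite tens_liftD // !tens_lift_mul // tens_liftD.
Qed.

Lemma tens_mulDr : right_distributive tens_mul +%R.
Proof.
move=> x y z; apply: tensZP => W b bb.
have bx c p := biadditive_mulr c p bb.
rewrite tens_liftD // !tens_lift_mul // [LHS]/tens_lift.
rewrite [X in _ = X + _]/tens_lift [X in _ = _ + X]/tens_lift /fsum -big_split /=.
by apply: eq_bigr => u _; rewrite tens_liftD.
Qed.

HB.instance Definition _ := GRing.Zmodule_isPzRing.Build T
  tens_mulA tens_mul1l tens_mul1r tens_mulDl tens_mulDr.

End ScalarExtensionRing.

(* Supercommutative superalgebras; [homog true] is the odd part.  An [algType]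
   is nonzero, which loses nothing for [End_GL]: over the zero ring any two
   matrices are equal. *)
Record superalg (k : fieldType) := MkSuperalg {
  sa_car :> algType k;
  homog : bool -> sa_car -> Prop;
  homog0 : forall d, homog d 0;
  homogD : forall d x y, homog d x -> homog d y -> homog d (x + y);
  homogZ : forall d (c : k) x, homog d x -> homog d (c *: x);
  homog_dec : forall x, exists2 u, homog false u & exists2 v, homog true v & x = u + v;
  homog_cap : forall x, homog false x -> homog true x -> x = 0;
  homog1 : homog false 1;
  homogM : forall d e x y, homog d x -> homog e y -> homog (d (+) e) (x * y);
  homogC : forall d e x y, homog d x -> homog e y -> x * y = (-1) ^+ (d && e) * (y * x)
}.

Section GL.
Variables (k : fieldType) (m n r : nat).

(* R-points of GL(m|n): a parity-preserving automorphism of the right R-module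
   V (x) R is given by its matrix, g e_j = \sum_i e_i g_ij; the inverse matrix
   is automatically even. *)
Definition GLpt (R : superalg k) (g : 'M[R]_(m + n)) : Prop :=
  (forall i j, homog (odd_ix i (+) odd_ix j) (g i j)) /\
  exists h : 'M[R]_(m + n), g *m h = 1%:M /\ h *m g = 1%:M.

(* The diagonal action of g: moving the coefficients of
   (\sum_i e_i g_(i, J 0)) (x) ... (x) (\sum_i e_i g_(i, J (r-1)))
   to the right, the coefficient in position a passes the vectors e_(I b) with
   a < b, which produces the sign. *)
Definition gl_act (R : superalg k) (g : 'M[R]_(m + n)) : tmx m n r R :=
  tmx_of (fun I J : tix m n r =>
    (-1) ^+ (\sum_(b < r) \sum_(a < r | (a < b)%N)
               ((odd_ix (I a) (+) odd_ix (J a)) && odd_ix (I b)))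
    * \prod_(a < r) g (I a) (J a)).

Definition End_GL (A : tmx m n r k) : Prop :=
  (forall I J, odd_tix I != odd_tix J -> tentry A I J = 0) /\
  (forall (R : superalg k) (g : 'M[R]_(m + n)), GLpt g ->
     gl_act g *m map_mx (in_alg R) A = map_mx (in_alg R) A *m gl_act g).

End GL.

Definition has_dim (k : fieldType) (V : vectType k) (P : V -> Prop) (d : nat) :=
  exists U : {vspace V}, (forall x, x \in U <-> P x) /\ \dim U = d.

Section Sigma.
Variables m n r : nat.

Definition base_change (K : comNzRingType) (A : tmx m n r int) : tmx m n r K :=
  map_mx intr A.

(* im(f~) \cap End(V_Z^(x)r), where Z[1/3] (x) End(V_Z^(x)r) is the matrix ring
   over Z[1/3], into which End(V_Z^(x)r) embeds entrywise. *)
Definition Sigma_pred : {pred tmx m n r int} := fun A =>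
  `[< exists a : grpalg Zthird r, sact m n a = base_change Zthird A >].

Lemma base_change_is_zmod_morphism (K : comNzRingType) : zmod_morphism (base_change K).
Proof. by move=> A B; rewrite /base_change map_mxB. Qed.

HB.instance Definition _ (K : comNzRingType) := GRing.isZmodMorphism.Build (tmx m n r int)
  (tmx m n r K) (base_change K) (base_change_is_zmod_morphism K).

Lemma base_change_is_monoid_morphism (K : comNzRingType) : monoid_morphism (base_change K).
Proof.
by split=> [|A B]; [exact: map_mx1 | exact: map_mxM].
Qed.

HB.instance Definition _ (K : comNzRingType) := GRing.isMonoidMorphism.Build (tmx m n r int)
  (tmx m n r K) (base_change K) (base_change_is_monoid_morphism K).

Lemma Sigma_subring : subring_closed Sigma_pred.
Proof.
split.
- by apply/asboolP; exists 1; rewrite !rmorph1.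
- move=> A B /asboolP[a aA] /asboolP[b bB]; apply/asboolP; exists (a - b).
  by rewrite !rmorphB /= aA bB.
- move=> A B /asboolP[a aA] /asboolP[b bB]; apply/asboolP; exists (a * b).
  by rewrite !rmorphM /= aA bB.
Qed.

Record SigmaZ :=
  MkSigmaZ { SigmaZ_val : tmx m n r int; _ : SigmaZ_val \in Sigma_pred }.

HB.instance Definition _ := [isSub for SigmaZ_val].
HB.instance Definition _ := [Choice of SigmaZ by <:].
HB.instance Definition _ := GRing.SubChoice_isSubPzRing.Build
  (tmx m n r int) Sigma_pred SigmaZ Sigma_subring.

Variable k : fieldType.

Definition Sigma := tensZ k SigmaZ.

(* Phi~, the map induced by the inclusion of SigmaZ in End(V_Z^(x)r). *)
Definition Phit (x : Sigma) : tmx m n r k :=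
  tens_lift (fun (a : k) A => a *: base_change k (SigmaZ_val A)) x.

Lemma Phit_biadditive :
  biadditive (fun (a : k) A => a *: base_change k (SigmaZ_val A)).
Proof.
split=> [A a c | a A B]; first by rewrite scalerDl.
by rewrite -scalerDr -rmorphD.
Qed.

Lemma Phit_is_linear : linear Phit.
Proof.
have bb := Phit_biadditive => c x y.
rewrite /Phit tens_liftD // tens_liftZ //; congr (_ + _).
rewrite /tens_lift /fsum scaler_sumr; apply: eq_bigr => u _.
by rewrite scalerA.
Qed.

HB.instance Definition _ :=
  GRing.isLinear.Build k Sigma (tmx m n r k) _ Phit Phit_is_linear.

Lemma Phit_is_monoid_morphism : monoid_morphism Phit.
Proof.
have bb := Phit_biadditive; split=> [|x y].
  by rewrite /Phit lift_pure // scale1r -[SigmaZ_val 1]/(val (1 : SigmaZ)) rmorph1.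
rewrite /Phit tens_lift_mul // {1}/tens_lift /fsum.
rewrite -[RHS]/(_ *m _) {2}/tens_lift /fsum mulmx_suml; apply: eq_bigr => u _.
rewrite /tens_lift /fsum mulmx_sumr; apply: eq_bigr => v _.
rewrite -scalemxAl -scalemxAr scalerA; congr (_ *: _).
by rewrite -[SigmaZ_val (_ * _)]/(val (_ * _ : SigmaZ)) rmorphM.
Qed.

HB.instance Definition _ :=
  GRing.isMonoidMorphism.Build Sigma (tmx m n r k) Phit Phit_is_monoid_morphism.

Lemma Phit_pure a A : Phit (pure a A) = a *: base_change k (SigmaZ_val A).
Proof. exact: lift_pure Phit_biadditive _ _. Qed.

End Sigma.

(* Main.v *)
Require Import Defs.
From HB Require Import structures.
From mathcomp Require Import all_boot all_order all_algebra all_fingroup.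
From mathcomp Require Import cyclic boolp zify ring.

(** Write V for the module of rank 2|1, W for its fifth tensor power, and let
    n be the sum of sign(s) s over S_5.  A basis vector of W is a word of five
    letters, of which a and b are even and c is odd.  The symmetric group acts
    on W from the left; multiplying an endomorphism A of W on the right by an
    element of the group algebra gives a second endomorphism.

    The new endomorphism.  If a word repeats an even letter, n kills it;
    otherwise it contains c at least three times, and a 3-cycle of these
    positions fixes it without a sign.  The 120 terms of n therefore fall into
    groups of three equal ones, and n acts as 3T with T an integral matrix
    ([alt_thirdZ]).  Modulo 3 this kills n, so that the image of the group
    algebra has dimension 119, but T survives.  On vectors that transform by
    the sign character, T is multiplication by 40 = 1, and its own image
    consists of such vectors.  Hence every X commuting with S_5, over any
    superalgebra, satisfies X T = T X T = T X ([alt_third_comm]), and T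
    commutes with GL(2|1).

    Nothing else commutes.  Over the dual numbers, an A commuting with GL(2|1)
    commutes with the derivations of the matrix units.  These suffice to move
    from one word to all others as long as only the multiplicities 1 and 2 have
    to be inverted ([lie_comm_vanish]); starting from aabbc and from aaccb, one
    finds that A (1 + t) comes from the group algebra for every transposition t
    ([sym_in_image]).  So A transforms by the sign character modulo the image
    of the group algebra.  The obstruction to correcting A by an element of the
    group algebra so that it transforms by the sign exactly is a class in
    H^2(S_5, k), which is zero; concretely, the correction is found for a
    3-cycle ([cycle_fix]), made compatible with a transposition, and extended to
    S_5 by averaging over a set of cosets whose number is prime to 3
    ([exists_rskew]).  The corrected map transforms by the sign on both sides,
    and such maps form the line spanned by T ([skew_eq0]).

    Kernel and integrality.  The signed stabilisers of aabbc and of aaccb add up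
    to 2 (1 + t), t the first transposition ([stab_sumE]).  Up to signs, twice
    the coefficients of a (1 + t) are therefore sums of two entries of the
    matrix of a.  If this matrix is zero, a (1 + t) = 0 for all t and a is a
    multiple of n.  If it is integral, the coefficients of a differ from those
    of a multiple c n by integers, and the entry 40 of T shows that 3c is an
    integer.  Both the ring generated by S_5 and n/3 and the injectivity of the
    scalar extension follow. *)

Set Implicit Arguments.
Unset Strict Implicit.
Unset Printing Implicit Defensive.

Import GRing.Theory.
Local Open Scope ring_scope.

(** * Permutations and the sign rule *)

(** A transposition of distance d + 2 is conjugate to one of distance d + 1 by an
    adjacent transposition, so the adjacent ones generate. *)
Lemma adj_perm_ind r (P : 'S_r -> Prop) :
  P 1%g -> (forall s t, P s -> P t -> P (s * t)%g) ->
  (forall i j : 'I_r, j = i.+1 :> nat -> P (tperm i j)) -> forall s, P s.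
Proof.
move=> P1 PM Padj.
have Plt d : forall i j : 'I_r, j = (i + d.+1)%N :> nat -> P (tperm i j).
  elim: d => [|d IH] i j ij; first by apply: Padj; rewrite ij addn1.
  have hk : (i + d.+1 < r)%N by have := ltn_ord j; lia.
  pose l := Ordinal hk.
  have lj : j = l.+1 :> nat by rewrite ij /= addnS.
  have -> : tperm i j = (tperm l j * (tperm i l * tperm l j))%g.
    have := tpermJ i l (tperm l j); rewrite tpermL tpermD; last first.
    - by apply/eqP => E; move: ij; rewrite E; lia.
    - by apply/eqP => /(congr1 val) /=; lia.
    by rewrite /conjg tpermV => <-.
  by apply: (PM); [exact: Padj|apply: (PM); [exact: IH|exact: Padj]].
have Pt i j : P (tperm i j).
  case: (ltngtP i j) => [ij|ji|/val_inj->]; last by rewrite tperm1.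
    by apply: (Plt (j - i.+1)%N); lia.
  by rewrite tpermC; apply: (Plt (i - j.+1)%N); lia.
move=> s; have [ts -> _] := prod_tpermP s.
by elim: ts => [|[i j] ts IH]; rewrite ?big_nil // big_cons; apply: PM.
Qed.

Section Signs.
Variables m n r : nat.
Local Notation tix := (tix m n r).
Local Notation sgx := (@sgn_exp m n r).

Lemma perm_tix1 (J : tix) : perm_tix 1 J = J.
Proof. by apply/ffunP=> k; rewrite ffunE invg1 perm1. Qed.

Lemma perm_tixK (s : 'S_r) : cancel (@perm_tix m n r s) (perm_tix s^-1).
Proof. by move=> J; rewrite -perm_tixM mulgV perm_tix1. Qed.

Lemma perm_tixVK (s : 'S_r) : cancel (@perm_tix m n r s^-1) (perm_tix s).
Proof. by move=> J; rewrite -perm_tixM mulVg perm_tix1. Qed.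

Lemma perm_tix_inj (s : 'S_r) : injective (@perm_tix m n r s).
Proof. exact: can_inj (perm_tixK s). Qed.

Lemma perm_tixE (s : 'S_r) (J : tix) k : perm_tix s J (s k) = J k.
Proof. by rewrite ffunE permK. Qed.

Lemma perm_tix_tperm i j (J : tix) : J i = J j -> perm_tix (tperm i j) J = J.
Proof.
by move=> E; apply/ffunP => k; rewrite ffunE tpermV; case: tpermP => [->|->|].
Qed.

Lemma sgn_exp_adj (i j : 'I_r) (J : tix) : j = i.+1 :> nat ->
  sgx (tperm i j) J = odd_ix (J i) && odd_ix (J j).
Proof.
move=> ij; rewrite /sgn_exp.
have E (u : 'I_r * 'I_r) :
    (u.1 < u.2)%N && (tperm i j u.2 < tperm i j u.1)%N = (u == (i, j)).
  case: u => a b /=; rewrite xpair_eqE.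
  case: tpermP => [->|->|/eqP b1 /eqP b2]; case: tpermP => [->|->|/eqP a1 /eqP a2];
    rewrite -?val_eqE /=; try lia;
    move: a1 a2 || idtac; move: b1 b2 || idtac; rewrite -?val_eqE /=; lia.
rewrite (_ : [set u | _] = if odd_ix (J i) && odd_ix (J j) then [set (i, j)] else set0).
  by case: (_ && _); rewrite ?cards1 ?cards0.
apply/setP => u; rewrite inE andbA E.
have [->|ne] := eqVneq u (i, j); first by rewrite /=; case: (odd_ix (J i) && _); rewrite ?inE ?eqxx.
by rewrite andFb; case: (_ && _); rewrite inE // (negPf ne).
Qed.

Lemma odd_sgn_exp1 (J : tix) : odd (sgx 1 J) = false.
Proof. by have := odd_sgn_expM 1 1 J; rewrite mulg1 perm_tix1; case: odd. Qed.

Lemma odd_sgn_expV s (J : tix) : odd (sgx s^-1 (perm_tix s J)) = odd (sgx s J).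
Proof. by have := odd_sgn_expM s^-1 s J; rewrite mulgV odd_sgn_exp1; do 2!case: odd. Qed.

(** An adjacent transposition of two odd letters costs one sign.  Conjugating by
    adjacent transpositions brings the two positions together, and the signs of
    the conjugation cancel because they are those of a permutation and its
    inverse. *)
Lemma odd_sgn_exp_tperm (i j : 'I_r) (J : tix) : i != j -> J i = J j ->
  odd (sgx (tperm i j) J) = odd_ix (J i).
Proof.
wlog ij : i j / (i < j)%N => [wl ne E|_].
  case: (ltngtP i j) => [/wl|ji|/val_inj eij]; first exact.
    by rewrite tpermC E; apply: wl => //; rewrite eq_sym.
  by rewrite eij eqxx in ne.
have [d] : exists d, j = (i + d.+1)%N :> nat by exists (j - i.+1)%N; lia.
elim: d j J {ij} => [|d IH] j J ij E.
  by rewrite sgn_exp_adj -?E ?andbb ?oddb // ij addn1.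
have hk : (i + d.+1 < r)%N by have := ltn_ord j; lia.
pose l := Ordinal hk.
have lj : j = l.+1 :> nat by rewrite ij /= addnS.
have ni : tperm l j i = i.
  by rewrite tpermD //; apply/eqP => /(congr1 val) /=; lia.
have -> : tperm i j = (tperm l j * (tperm i l * tperm l j))%g.
  have := tpermJ i l (tperm l j); rewrite tpermL ni.
  by rewrite /conjg tpermV => <-.
pose J' := perm_tix (tperm l j) J.
have Ei : J' i = J i by rewrite -{1}ni perm_tixE.
have El : J' l = J j by rewrite -{1}(tpermR l j) perm_tixE.
have -> : odd (sgx (tperm l j * (tperm i l * tperm l j))%g J) =
   odd (sgx (tperm l j) (perm_tix (tperm i l) J')) (+) odd (sgx (tperm i l) J')
     (+) odd (sgx (tperm l j) J).
  by rewrite odd_sgn_expM odd_sgn_expM.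
rewrite (IH l J') //; last by rewrite Ei El.
rewrite (perm_tix_tperm (i := i)) ?Ei ?El // -(tpermV l j) odd_sgn_expV tpermV.
by case: odd; case: odd_ix.
Qed.

End Signs.

(** * Equivariance of the diagonal action of GL *)

Lemma prod_split_adj (R : pzRingType) r (i j : 'I_r) (f : 'I_r -> R) :
  j = i.+1 :> nat ->
  \prod_(a < r) f a =
  (\prod_(0 <= k < i) oapp f 1 (insub k)) * (f i * f j)
    * (\prod_(j.+1 <= k < r) oapp f 1 (insub k)).
Proof.
move=> ij; pose F k := oapp f 1 (insub k).
rewrite (eq_bigr (fun a : 'I_r => F a)) => [|a _]; last by rewrite /F valK.
rewrite -(big_mkord xpredT F) (@big_cat_nat _ _ _ i) //=; last exact: ltnW.
rewrite -mulrA; congr (_ * _).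
rewrite big_ltn // -ij big_ltn // mulrA; congr (_ * _ * _).
  by rewrite /F valK.
by rewrite /F valK.
Qed.

Lemma prod_tperm_adj (R : pzRingType) r (i j : 'I_r) (f : 'I_r -> R) e :
  j = i.+1 :> nat -> f i * f j = (-1) ^+ e * (f j * f i) ->
  \prod_(a < r) f a = (-1) ^+ e * \prod_(a < r) f (tperm i j a).
Proof.
move=> ij fij; rewrite !(prod_split_adj _ ij) tpermL tpermR fij.
have out k : ((k < i) || (j < k))%N ->
    oapp (fun a => f (tperm i j a)) 1 (insub k) = oapp f 1 (insub k).
  case: insubP => //= a _ <- ka; congr f.
  by rewrite tpermD //; apply/eqP => E; move: ka; rewrite -E; lia.
rewrite [in RHS](eq_big_nat _ _ (F2 := fun k => oapp f 1 (insub k))); last first.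
  by move=> k /andP[_ ki]; rewrite out ?ki.
rewrite [X in _ = _ * (_ * X)](eq_big_nat _ _ (F2 := fun k => oapp f 1 (insub k))); last first.
  by move=> k /andP[jk _]; rewrite out // jk orbT.
by rewrite !mulrA; congr (_ * _ * _ * _); rewrite -signr_odd commr_sign.
Qed.

(** An adjacent transposition keeps the order of every pair of positions except
    the pair that it exchanges. *)
Lemma sum_pairs_tperm_adj r (i j : 'I_r) (F : 'I_r -> 'I_r -> nat) :
  j = i.+1 :> nat ->
  (\sum_(b < r) \sum_(a < r | (a < b)%N) F (tperm i j a) (tperm i j b) + F i j =
  \sum_(b < r) \sum_(a < r | (a < b)%N) F a b + F j i)%N.
Proof.
move=> ij; set s := tperm i j.
rewrite !pair_big_dep /=.
rewrite (bigD1 (j, i)) /= ?ij // [in RHS](bigD1 (j, i)) /= ?ij //.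
rewrite /s tpermL tpermR -/s addnAC [RHS]addnAC (addnC (F j i)); congr (_ + _)%N.
rewrite [RHS](reindex (fun u : 'I_r * 'I_r => (s u.1, s u.2))) /=; last first.
  by exists (fun u => (s u.1, s u.2)) => -[a b] _ /=; rewrite /s !tpermK.
apply: eq_bigl => -[a b] /=; rewrite !xpair_eqE.
rewrite /s; case: tpermP => [->|->|/eqP a1 /eqP a2];
  case: tpermP => [->|->|/eqP b1 /eqP b2];
  rewrite -?val_eqE /=; try lia;
  move: a1 a2 || idtac; move: b1 b2 || idtac; rewrite -?val_eqE /=; lia.
Qed.

Section Equivariant.
Variables m n r : nat.
Local Notation tix := (tix m n r).
Local Notation sgx := (@sgn_exp m n r).

Lemma tentry_mulE (K : pzRingType) (A B : tmx m n r K) I J :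
  tentry (A *m B) I J = \sum_(L : tix) tentry A I L * tentry B L J.
Proof.
rewrite /tentry mxE (reindex _ (onW_bij _ (@enum_rank_bij tix))) /=.
by apply: eq_bigr.
Qed.

Section Ring.
Variable K : pzRingType.
Implicit Type A : tmx m n r K.

Lemma tentry_mul_perm A s I J :
  tentry (A *m perm_act _ _ K s) I J =
  tentry A I (perm_tix s J) * (-1) ^+ sgx s J.
Proof.
rewrite tentry_mulE (bigD1 (perm_tix s J)) //= big1 => [|L /negPf LJ].
  by rewrite addr0 tmx_ofE eqxx.
by rewrite tmx_ofE LJ mulr0.
Qed.

Lemma tentry_perm_mul A s I J :
  tentry (perm_act _ _ K s *m A) (perm_tix s I) J = (-1) ^+ sgx s I * tentry A I J.
Proof.
rewrite tentry_mulE (bigD1 I) //= big1 => [|L LJ].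
  by rewrite addr0 tmx_ofE eqxx.
by rewrite tmx_ofE (inj_eq (@perm_tix_inj _ _ _ s)) eq_sym (negPf LJ) mul0r.
Qed.

Lemma comm_permP A s :
  (forall I J, tentry A (perm_tix s I) (perm_tix s J) =
     (-1) ^+ (sgx s I + sgx s J) * tentry A I J) <->
  A *m perm_act _ _ K s = perm_act _ _ K s *m A.
Proof.
split=> [E|E I J].
  apply: tmxP => I J; rewrite -(perm_tixVK s I) tentry_mul_perm tentry_perm_mul E.
  rewrite exprD -!mulrA; congr (_ * _).
  by rewrite [tentry _ _ _ * _]commr_sign signrMK.
have := congr1 (fun B => tentry B (perm_tix s I) J) E.
rewrite tentry_mul_perm tentry_perm_mul => {}E.
rewrite exprD -mulrA -(commr_sign (tentry A I J)) mulrA -E -mulrA.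
by rewrite -expr2 sqrr_sign mulr1.
Qed.

End Ring.

Lemma map_perm_act (K R : pzRingType) (f : {rmorphism K -> R}) (s : 'S_r) :
  map_mx f (perm_act m n K s) = perm_act m n R s.
Proof.
apply: tmxP => I J; rewrite /tentry mxE -/(tentry _ I J) -[RHS]/(tentry _ I J).
by rewrite !tmx_ofE; case: eqP; rewrite ?rmorph0 // rmorph_sign.
Qed.

(** It suffices to exchange two adjacent factors.  Supercommutativity gives the
    sign of exchanging g_(IJ) and g_(I'J'), whose parities are I + J and I' + J';
    the sign in front of the product changes by JI' + J'I, and the total
    II' + JJ' is the difference of the signs of the transposition on the two
    words. *)
Lemma gl_act_equivariant (k : fieldType) (R : superalg k) (g : 'M[R]_(m + n)) s :
  (forall i j, homog (odd_ix i (+) odd_ix j) (g i j)) ->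
  gl_act r g *m perm_act m n R s = perm_act m n R s *m gl_act r g.
Proof.
move=> gh; elim/adj_perm_ind: s => [|s t sP tP|i j ij].
- have -> : perm_act m n R 1%g = 1%:M :> tmx m n r R.
    apply: tmxP => I J; rewrite tmx_ofE /tentry mxE (inj_eq enum_rank_inj).
    by rewrite perm_tix1 -signr_odd odd_sgn_exp1 expr0; case: eqP.
  by rewrite mulmx1 mul1mx.
- have -> : perm_act m n R (s * t)%g = perm_act m n R t *m perm_act m n R s :> tmx m n r R.
    apply: tmxP => I J; rewrite tentry_mul_perm !tmx_ofE perm_tixM.
    case: eqP => _; last by rewrite mul0r.
    by rewrite -signr_odd odd_sgn_expM signr_addb !signr_odd.
  by rewrite mulmxA tP -[LHS]mulmxA sP mulmxA.
apply/comm_permP => I J; rewrite !tmx_ofE.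
pose F a b := nat_of_bool ((odd_ix (I a) (+) odd_ix (J a)) && odd_ix (I b)).
have pE (L : tix) a : perm_tix (tperm i j) L a = L (tperm i j a).
  by rewrite ffunE tpermV.
have EF := sum_pairs_tperm_adj F ij; rewrite /F in EF.
under eq_bigr do under eq_bigr do rewrite !pE.
under [\prod_(a < r) g (perm_tix _ _ _) _]eq_bigr do rewrite !pE.
set E1 := (\sum_(b < r) _)%N in EF *; set E2 := (\sum_(b < r) _)%N in EF *.
set e := (odd_ix (I i) (+) odd_ix (J i)) && (odd_ix (I j) (+) odd_ix (J j)).
rewrite (@prod_tperm_adj _ _ i j (fun a => g (I a) (J a)) e ij); last first.
  exact: homogC (gh _ _) (gh _ _).
rewrite !mulrA; congr (_ * _); rewrite -!exprD -signr_odd -[RHS]signr_odd.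
congr (_ ^+ _); congr nat_of_bool.
move/(congr1 odd): EF; rewrite !oddD !sgn_exp_adj // !oddb /e.
by do 2!case: odd; do 4!case: odd_ix.
Qed.

End Equivariant.

(** * Dual numbers *)

Section DualNumbers.
Variable k : fieldType.

(** The pair (x, y) stands for x + y eps with eps^2 = 0.  The alias keeps the
    componentwise product of pairs from being used. *)
Definition dual := (k^o * k^o)%type.

HB.instance Definition _ := GRing.Lmodule.on dual.

Definition dual_mul (x y : dual) : dual := (x.1 * y.1, x.1 * y.2 + x.2 * y.1).

Lemma dual_mulA : associative dual_mul.
Proof.
by move=> [a b] [c d] [e f]; rewrite /dual_mul /= !mulrDr !mulrDl !mulrA addrA.
Qed.

Lemma dual_mulC : commutative dual_mul.
Proof.
move=> [a b] [c d]; rewrite /dual_mul /=.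
by rewrite [a * c]mulrC [a * d]mulrC [b * c]mulrC addrC.
Qed.

Lemma dual_mul1 : left_id ((1, 0) : dual) dual_mul.
Proof. by move=> [a b]; rewrite /dual_mul /= !mul1r mul0r addr0. Qed.

Lemma dual_mulD : left_distributive dual_mul +%R.
Proof.
move=> [a b] [c d] [e f]; rewrite /dual_mul /=; congr (_, _).
  exact: mulrDl.
by rewrite /= !mulrDl addrACA.
Qed.

Lemma dual_1neq0 : ((1, 0) : dual) != 0.
Proof. by rewrite xpair_eqE oner_eq0. Qed.

HB.instance Definition _ := GRing.Zmodule_isComNzRing.Build dual
  dual_mulA dual_mulC dual_mul1 dual_mulD dual_1neq0.

Lemma dual_scaleAl (a : k) (x y : dual) : a *: (x * y) = (a *: x : dual) * y.
Proof.
apply: injective_projections => /=; first exact: (scalerAl a (x.1 : k^o) y.1).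
by rewrite -[LHS]/((a : k) * (x.1 * y.2 + x.2 * y.1)) mulrDr !mulrA.
Qed.

HB.instance Definition _ := GRing.Lmodule_isLalgebra.Build k dual dual_scaleAl.

Lemma dual_scaleAr (a : k) (x y : dual) : a *: (x * y) = x * (a *: y).
Proof. by rewrite mulrC dual_scaleAl mulrC. Qed.

HB.instance Definition _ := GRing.Lalgebra_isAlgebra.Build k dual dual_scaleAr.

(** The parity of eps is [d]: both cases are supercommutative since eps^2 = 0,
    which gives points of the even and of the odd root subgroups uniformly. *)
Definition dual_homog (d e : bool) (x : dual) : Prop :=
  (e -> x.1 = 0) /\ (d != e -> x.2 = 0).

Program Definition dual_superalg (d : bool) : superalg k :=
  @MkSuperalg k dual (dual_homog d) _ _ _ _ _ _ _ _.
Next Obligation. by []. Qed.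
Next Obligation.
by case: x y H H0 => [a b] [a' b'] [/= x1 x2] [/= y1 y2]; split=> /= h;
  rewrite ?x1 ?x2 ?y1 ?y2 ?addr0.
Qed.
Next Obligation.
by case: x H => [a b] [/= x1 x2]; split=> /= h;
  rewrite ?x1 ?x2 ?scaler0.
Qed.
Next Obligation.
case: x => a b.
exists (a, if d then 0 else b); first by split=> //=; case: d.
exists (0, if d then b else 0); first by split=> //=; case: d.
by case: d; apply: injective_projections; rewrite /= ?addr0 ?add0r.
Qed.
Next Obligation.
case: x H H0 => a b [/= x1 x2] [/= y1 y2]; rewrite y1 //.
by case: d x2 y2 => x2 y2; [rewrite x2 | rewrite y2].
Qed.
Next Obligation. by []. Qed.
Next Obligation.
case: H H0 => x1 x2 [y1 y2]; split=> h.
  rewrite -[LHS]/(x.1 * y.1).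
  by case: d0 e x1 y1 h {x2 y2} => [] [] // x1 y1 _; rewrite ?(x1 isT) ?(y1 isT) ?mul0r ?mulr0.
rewrite -[LHS]/(x.1 * y.2 + x.2 * y.1).
by case: d d0 e x1 x2 y1 y2 h => [] [] [] //= x1 x2 y1 y2 _;
  rewrite ?(x1 isT) ?(x2 isT) ?(y1 isT) ?(y2 isT) ?mul0r ?mulr0 ?addr0.
Qed.
Next Obligation.
rewrite -[LHS]/(dual_mul x y) -[X in _ * X]/(dual_mul y x) dual_mulC.
case: d0 e H H0 => [] [] [x1 _] [y1 _]; rewrite /= ?expr0 ?expr1 ?mul1r //.
by rewrite /dual_mul x1 // y1 // !mul0r !mulr0 addr0 mulr0.
Qed.

End DualNumbers.

(** * The infinitesimal action of the matrix units *)

Lemma dual2X (k : fieldType) e (x : dual k) : ((-1) ^+ e * x).2 = (-1) ^+ e * x.2.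
Proof.
rewrite -signr_odd -[in RHS]signr_odd; case: odd; last by rewrite !expr0 !mul1r.
by rewrite !expr1 !mulN1r.
Qed.

Lemma dual2_sum (k : fieldType) I (s : seq I) P (F : I -> dual k) :
  (\sum_(i <- s | P i) F i).2 = \sum_(i <- s | P i) (F i).2.
Proof. exact: (big_morph (fun x : dual k => x.2)). Qed.

Lemma dual2_inl (k : fieldType) (a : k) (x : dual k) : (a%:A * x).2 = a * x.2.
Proof.
by rewrite -[LHS]/((a * 1) * x.2 + (a * 0) * x.1) mulr1 mulr0 mul0r addr0.
Qed.

Lemma dual2_inr (k : fieldType) (a : k) (x : dual k) : (x * a%:A).2 = x.2 * a.
Proof. by rewrite mulrC dual2_inl mulrC. Qed.

Lemma dual_prod (k : fieldType) (T : eqType) (s : seq T) (x y : T -> k) :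
  uniq s -> \prod_(a <- s) ((x a, y a) : dual k) =
   (\prod_(a <- s) x a, \sum_(q <- s) y q * \prod_(a <- s | a != q) x a).
Proof.
elim: s => [|b s IH] /=; first by rewrite !big_nil.
case/andP => bs us; rewrite !big_cons IH // eqxx /=.
apply: injective_projections => //=.
rewrite addrC; congr (_ + _).
  congr (_ * _); rewrite [LHS]big_seq [RHS]big_seq_cond; apply: eq_bigl => a.
  by case: eqVneq => [->|]; rewrite ?andbT // (negPf bs).
rewrite mulr_sumr [LHS]big_seq [RHS]big_seq; apply: eq_bigr => q qs.
rewrite big_cons; case: eqVneq => [bq|_]; last by rewrite mulrCA.
by rewrite bq qs in bs.
Qed.

Section Derivations.
Variables (k : fieldType) (m n r : nat).
Local Notation tix := (tix m n r).
Local Notation sgx := (@sgn_exp m n r).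
Implicit Types (i j : 'I_(m + n)) (I J L : tix) (A B : tmx m n r k).

Definition subst_letter J q i : tix := [ffun a => if a == q then i else J a].

(** The sign exponent in the diagonal action of GL. *)
Definition gl_exp I J : nat :=
  \sum_(b < r) \sum_(a < r | (a < b)%N)
     ((odd_ix (I a) (+) odd_ix (J a)) && odd_ix (I b)).

Definition eps_mx i j : 'M[dual k]_(m + n) :=
  \matrix_(p, q) (0, ((p == i) && (q == j))%:R).

Lemma eps_mx_nil i j : eps_mx i j *m eps_mx i j = 0.
Proof.
apply/matrixP => p q; rewrite !mxE big1 // => l _; rewrite !mxE.
by apply: injective_projections => /=; rewrite !mul0r ?mulr0 ?addr0.
Qed.

Lemma GLpt_eps i j :
  @GLpt k m n (dual_superalg k (odd_ix i (+) odd_ix j)) (1%:M + eps_mx i j).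
Proof.
split; last first.
  exists (1%:M - eps_mx i j).
  rewrite mulmxDl !mul1mx mulmxBr mulmx1 eps_mx_nil subr0.
  split; first by rewrite subrK.
  by rewrite mulmxDr mulmx1 mulmxBl mul1mx eps_mx_nil subr0 subrK.
move=> p q; rewrite !mxE; split => /= h.
  by case: eqP h => [->|_ _]; rewrite ?addbb // addr0.
case: (p =P q) => [_|_] /=; rewrite add0r;
  by case: andP h => // -[/eqP-> /eqP->]; rewrite eqxx.
Qed.

(** The derivative of the action at the identity in the direction of a matrix
    unit. *)
Definition lie_op i j : tmx m n r k :=
  map_mx (fun x : dual k => x.2)
    (gl_act (R := dual_superalg k (odd_ix i (+) odd_ix j)) r (1%:M + eps_mx i j)).

Lemma lie_opE i j I J : tentry (lie_op i j) I J =
  (-1) ^+ gl_exp I J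
    * \sum_(q < r) ((J q == j) && (I == subst_letter J q i))%:R.
Proof.
rewrite /tentry mxE -/(tentry _ I J) tmx_ofE dual2X; congr (_ * _).
under eq_bigr => a _.
  rewrite !mxE.
  rewrite (_ : _ + _ = ((I a == J a)%:R, ((I a == i) && (J a == j))%:R) :> dual k).
    over.
  by case: (I a == J a); apply: injective_projections; rewrite /= ?addr0 ?add0r.
rewrite (dual_prod _ _ (index_enum_uniq _)) /=; apply: eq_bigr => q _.
have [->|ne] := eqVneq I (subst_letter J q i).
  rewrite ffunE !eqxx andbT big1 ?mulr1 // => a /negPf aq.
  by rewrite ffunE aq eqxx.
rewrite andbF; case: (I q =P i) => [Iq|_]; last by rewrite mul0r.
have /existsP[a /andP[aq Ia]] : [exists a, (a != q) && (I a != J a)].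
  rewrite -negb_forall_in; apply: contra ne => /forall_inP h.
  apply/eqP/ffunP => a; rewrite ffunE; case: eqVneq => [->//|aq].
  exact/eqP/h.
by rewrite (bigD1 a) //= (negPf Ia) mul0r mulr0.
Qed.

Lemma gl_exp_id J : gl_exp J J = 0%N.
Proof. by rewrite /gl_exp big1 // => b _; rewrite big1 // => a _; rewrite addbb. Qed.

Definition mult i J : nat := #|[pred q | J q == i]|.

(** The diagonal matrix units measure the weight of a word, but only as an
    element of k. *)
Lemma lie_op_diagE i I J : tentry (lie_op i i) I J = if I == J then (mult i J)%:R else 0.
Proof.
have E q : J q == i -> subst_letter J q i = J.
  by move/eqP => Jq; apply/ffunP => a; rewrite ffunE; case: eqP => [->|].
rewrite lie_opE; case: eqP => [->|ne].
  rewrite gl_exp_id mul1r /mult -sum1_card natr_sum [RHS]big_mkcond /=.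
  apply: eq_bigr => q _; rewrite inE.
  by case: (boolP (J q == i)) => //= /E ->; rewrite eqxx.
rewrite big1 ?mulr0 // => q _.
by case: (boolP (J q == i)) => //= /E ->; case: eqP.
Qed.

Lemma tentry_mul_lie_op B i j I J :
  tentry (B *m lie_op i j) I J =
  \sum_(q | J q == j) (-1) ^+ gl_exp (subst_letter J q i) J
     * tentry B I (subst_letter J q i).
Proof.
rewrite tentry_mulE.
under eq_bigr do rewrite lie_opE mulrA mulr_sumr.
rewrite exchange_big /= [RHS]big_mkcond; apply: eq_bigr => q _.
rewrite (bigD1 (subst_letter J q i)) //= big1 => [|L /negPf->]; last first.
  by rewrite andbF mulr0.
by rewrite eqxx andbT addr0; case: eqP; rewrite ?mulr1 ?mulr0 // mulrC.
Qed.

Definition lie_comm A := forall i j, A *m lie_op i j = lie_op i j *m A.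

Lemma End_GL_lie_comm A : End_GL A -> lie_comm A.
Proof.
case=> _ h i j; have {h} := h _ _ (GLpt_eps i j).
move/(congr1 (map_mx (fun x : dual k => x.2))) => /matrixP E.
apply/matrixP => u v; have := E u v; rewrite !mxE !dual2_sum.
rewrite (eq_bigr (fun l => lie_op i j u l * A l v)) => [->|l _]; last first.
  by rewrite [map_mx _ A l v]mxE [lie_op i j u l]mxE; apply: dual2_inr.
by apply: eq_bigr => l _; rewrite [map_mx _ A u l]mxE [lie_op i j l v]mxE; apply/esym/dual2_inl.
Qed.

End Derivations.

Section Commutant.
Variables (k : fieldType) (m n r : nat).
Local Notation tix := (tix m n r).
Local Notation sgx := (@sgn_exp m n r).
Local Notation P := (@perm_act m n r k).
Local Notation lie_op := (@lie_op k m n r).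
Implicit Types (i j : 'I_(m + n)) (I J L : tix) (A B : tmx m n r k).

Lemma odd_perm_tix s J : odd_tix (perm_tix s J) = odd_tix J.
Proof.
rewrite /odd_tix (reindex_inj (@perm_inj _ s)) /=.
by apply: eq_bigr => a _; rewrite perm_tixE.
Qed.

Lemma End_GL_perm_act s : End_GL (P s).
Proof.
split=> [I J|R g [gh _]]; last by rewrite map_perm_act gl_act_equivariant.
by move=> ne; rewrite tmx_ofE; case: (I =P _) ne => // ->; rewrite odd_perm_tix eqxx.
Qed.

Lemma lie_comm0 : lie_comm (0 : tmx m n r k).
Proof. by move=> i j; rewrite mul0mx mulmx0. Qed.

Lemma lie_commD A B : lie_comm A -> lie_comm B -> lie_comm (A + B).
Proof. by move=> cA cB i j; rewrite mulmxDl mulmxDr cA cB. Qed.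

Lemma lie_commZ c A : lie_comm A -> lie_comm (c *: A).
Proof. by move=> cA i j; rewrite -scalemxAl -scalemxAr cA. Qed.

Lemma lie_commM A B : lie_comm A -> lie_comm B -> lie_comm (A *m B).
Proof. by move=> cA cB i j; rewrite -mulmxA cB !mulmxA cA. Qed.

Lemma lie_comm_perm s : lie_comm (P s).
Proof. exact/End_GL_lie_comm/End_GL_perm_act. Qed.

Lemma lie_comm_sact (a : grpalg k r) : lie_comm (sact m n a).
Proof.
rewrite /sact; elim/big_rec: _ => [|s A _ cA]; first exact: lie_comm0.
by apply: lie_commD => //; apply/lie_commZ/lie_comm_perm.
Qed.

(** Exchanging the words only matters for pairs a < b at which both differ. *)
Lemma gl_expC I J : (forall a b : 'I_r, (a < b)%N -> odd_ix (I a) != odd_ix (J a) ->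
  odd_ix (I b) = odd_ix (J b)) -> gl_exp I J = gl_exp J I.
Proof.
move=> h; apply: eq_bigr => b _; apply: eq_bigr => a ab.
have := h _ _ ab; rewrite addbC.
by case: odd_ix; case: odd_ix => //= ->.
Qed.

(** The sign in an entry only depends on the letters after the changed position,
    and these are the same in both words. *)
Lemma lie_op_tr i j : (lie_op i j)^T = lie_op j i.
Proof.
apply: tmxP => I J; rewrite /tentry mxE -/(tentry _ J I) -/(tentry _ I J).
rewrite !lie_opE.
have E q : (I q == j) && (J == subst_letter I q i) =
           (J q == i) && (I == subst_letter J q j).
  apply/andP/andP => -[/eqP Eq /eqP ->]; rewrite !ffunE !eqxx; split=> //;
    by apply/eqP/ffunP => a; rewrite !ffunE; case: eqP => // ->.
under eq_bigr do rewrite E.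
have [/existsP[q /andP[_ /eqP IJ]]|/existsPn h] :=
   boolP [exists q, (J q == i) && (I == subst_letter J q j)].
  rewrite gl_expC // => a b ab; rewrite IJ !ffunE.
  case: (a =P q) => [aq|_]; last by rewrite eqxx.
  by case: (b =P q) => // bq; rewrite aq bq ltnn in ab.
by rewrite big1 ?mulr0 // => q _; rewrite (negPf (h q)).
Qed.

Lemma lie_comm_tr A : lie_comm A -> lie_comm A^T.
Proof. by move=> cA i j; rewrite -lie_op_tr -!trmx_mul cA. Qed.

Lemma lie_comm_mult A : lie_comm A -> forall I J i, tentry A I J != 0 ->
  (mult i I)%:R = (mult i J)%:R :> k.
Proof.
move=> cA I J i nz; have := congr1 (fun B => tentry B I J) (cA i i).
rewrite !tentry_mulE.
rewrite (bigD1 J) //= lie_op_diagE eqxx big1 => [|L /negPf LJ]; last first.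
  by rewrite lie_op_diagE LJ mulr0.
rewrite (bigD1 I) //= lie_op_diagE eqxx big1 => [|L /negPf LI]; last first.
  by rewrite lie_op_diagE eq_sym LI mul0r.
by rewrite !addr0 mulrC => /(mulIf nz).
Qed.

(** Induction on the number of positions at which J differs from J0.  Restore
    one of these positions to the letter j of J0, obtaining J', and apply the
    derivation that replaces j by the letter x of J: it sends J' to J, to words
    that arise from J by a transposition inside the fibre of j, and to words
    closer to J0.  The symmetry of B makes all terms of the first two kinds
    equal, and their number is at most the size of the fibre. *)
Lemma lie_comm_vanish J0 B :
  (forall p c, (0 < c <= mult (J0 p) J0)%N -> c%:R != 0 :> k) ->
  lie_comm B ->
  (forall p q, p != q -> J0 p = J0 q ->
     B *m P (tperm p q) = (-1) ^+ odd_ix (J0 p) *: B) ->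
  (forall I, tentry B I J0 = 0) -> B = 0.
Proof.
move=> small cB tB B0; apply: tmxP => I J; rewrite [RHS]mxE.
have [d] := ubnP #|[pred p | J p != J0 p]|.
elim: d J I => // d IH J I; rewrite ltnS => dJ.
have [/existsP[p Jp]|/existsPn h] := boolP [exists p, J p != J0 p]; last first.
  suff -> : J = J0 by apply: B0.
  by apply/ffunP => p; apply/eqP; have := h p; rewrite negbK.
set j := J0 p; set x := J p; pose J' := subst_letter J p j.
have xj : x != j by [].
have J'p : J' p = j by rewrite ffunE eqxx.
have J'x : subst_letter J' p x = J.
  by apply/ffunP => a; rewrite !ffunE; case: eqP => // ->.
have dJ' : (#|[pred q | J' q != J0 q]| < #|[pred q | J q != J0 q]|)%N.
  apply/proper_card/properP; split.
    apply/subsetP => q; rewrite !inE ffunE; case: (q =P p) => [->|//].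
    by rewrite eqxx.
  by exists p; rewrite !inE // J'p eqxx.
have := congr1 (fun A => tentry A I J') (cB x j).
rewrite tentry_mulE [in RHS]tentry_mulE /= [RHS]big1; last first.
  by move=> L _; rewrite IH ?mulr0 //; apply: leq_trans dJ.
rewrite -tentry_mulE tentry_mul_lie_op (bigID (fun q => J0 q == j)) /=.
rewrite [X in _ + X]big1 ?addr0; last first.
  move=> q /andP[/eqP J'q J0q]; rewrite IH ?mulr0 //.
  apply: leq_trans dJ; apply: leq_ltn_trans dJ'; apply/subset_leq_card.
  apply/subsetP => a; rewrite !inE [subst_letter _ _ _ _]ffunE.
  by case: (a =P q) => // -> _; rewrite J'q eq_sym.
pose c0 : k := (-1) ^+ gl_exp J J'.
rewrite (eq_bigr (fun=> c0 * tentry B I J)); last first.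
  move=> q /andP[/eqP J'q /eqP J0q].
  have [->|qp] := eqVneq q p; first by rewrite J'x.
  set Jq := subst_letter J' q x.
  have tJ' : perm_tix (tperm p q) J' = J'.
    by apply: perm_tix_tperm; rewrite J'p J'q.
  have tJ : perm_tix (tperm p q) J = Jq.
    apply/ffunP => a; rewrite !ffunE tpermV.
    case: tpermP => [->|->|/eqP/negPf ap /eqP/negPf aq]; rewrite ?eqxx //.
      by rewrite eq_sym (negPf qp) -J'q ffunE (negPf qp).
    by rewrite aq ap.
  have {}tB := congr1 (fun A => tentry A I J) (tB p q _ (esym J0q)).
  have := tB; rewrite eq_sym => /(_ qp); rewrite tentry_mul_perm tJ.
  rewrite /tentry mxE -!/(tentry _ _ _) -/j => EB.
  have /comm_permP ED : lie_op x j *m P (tperm p q) = P (tperm p q) *m lie_op x j.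
    by rewrite lie_comm_perm.
  have {}ED := ED J J'; rewrite tJ tJ' !lie_opE in ED.
  have sum1 K s : s \in [:: p; q] -> K = subst_letter J' s x ->
     \sum_(a < r) ((J' a == j) && (K == subst_letter J' a x))%:R = 1 :> k.
    move=> sp ->; rewrite (bigD1 s) //= big1 => [|a as_].
      by rewrite eqxx andbT addr0; move: sp; rewrite !inE => /orP[]/eqP->;
         rewrite ?J'p ?J'q eqxx.
    case: eqP => // J'a; case: eqP => // /ffunP/(_ a); rewrite !ffunE (negPf as_) eqxx.
    move: J'a; rewrite ffunE => -> E; by rewrite E eqxx in xj.
  rewrite (sum1 Jq q) ?inE ?eqxx ?orbT // (sum1 J p) ?inE ?eqxx // in ED.
  move: ED; rewrite !mulr1 => ->; rewrite exprD -/c0.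
  have -> : (-1) ^+ sgx (tperm p q) J' = (-1) ^+ odd_ix j :> k.
    by rewrite -signr_odd odd_sgn_exp_tperm ?J'p // eq_sym.
  rewrite mulrAC -mulrA mulrAC.
  have := congr1 (fun y => (-1) ^+ odd_ix j * y) EB.
  rewrite signrMK => <-.
  by move: (_ ^+ _) ((-1) ^+ _) (tentry _ _ _) c0 => u v w c; ring.
rewrite sumr_const -mulr_natl => /eqP; rewrite !mulf_eq0 signr_eq0 /=.
case/orP => [|/eqP//]; apply: contraTeq => _; apply: (small p).
apply/andP; split; first by apply/card_gt0P; exists p; rewrite -topredE /= J'p !eqxx.
by apply/subset_leq_card/subsetP => q; rewrite -topredE inE /= => /andP[].
Qed.

End Commutant.

(** * The group algebra and its image *)

Section GroupAlgebra.
Variables (K : comNzRingType) (r : nat).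
Implicit Types (a b : grpalg K r) (s t u : 'S_r).

Lemma grpalg_mulgrpE a t u : (a * grp K t) u = a (t^-1 * u)%g.
Proof.
rewrite grpalg_mulE (bigD1 (t^-1 * u)%g) //= big1 => [|s st].
  by rewrite ffunE invMg mulKVg invgK eqxx mulr1 addr0.
rewrite ffunE; case: eqP => [E|_]; last by rewrite mulr0.
by case/eqP: st; rewrite -E invMg invgK mulgKV.
Qed.

Lemma grpalg_grpmulE a t u : (grp K t * a) u = a (u * t^-1)%g.
Proof.
rewrite grpalg_mulE (bigD1 t) //= big1 => [|s /negPf st].
  by rewrite ffunE eqxx mul1r addr0.
by rewrite ffunE st mul0r.
Qed.

Lemma grp1 : grp K (1 : 'S_r)%g = 1.
Proof. by []. Qed.

Lemma grpM s t : grp K s * grp K t = grp K (t * s)%g.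
Proof.
by apply/ffunP => u; rewrite grpalg_mulgrpE !ffunE -(inj_eq (mulgI t)) mulKVg.
Qed.

Lemma mul_sym_conj a t u :
  a * (1 + grp K (t ^ u)%g) = a * grp K u * (1 + grp K t) * grp K u^-1.
Proof. by rewrite !mulrDr !mulr1 mulrDl -!mulrA !grpM mulVg grp1 mulr1 /conjg mulgA. Qed.

Definition alt (c : K) : grpalg K r := [ffun s : 'S_r => c * (-1) ^+ s].

Lemma alt_grp c t : alt c * grp K t = alt (c * (-1) ^+ t).
Proof.
apply/ffunP => u; rewrite grpalg_mulgrpE !ffunE odd_permM odd_permV signr_addb.
by rewrite mulrA.
Qed.

Lemma grp_alt c t : grp K t * alt c = alt (c * (-1) ^+ t).
Proof.
apply/ffunP => u; rewrite grpalg_grpmulE !ffunE odd_permM odd_permV signr_addb.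
by rewrite mulrCA mulrC mulrAC.
Qed.

Lemma alt_is_zmod_morphism : zmod_morphism alt.
Proof. by move=> c d; apply/ffunP => u; rewrite !ffunE mulrBl. Qed.

HB.instance Definition _ :=
  GRing.isZmodMorphism.Build K (grpalg K r) alt alt_is_zmod_morphism.

Lemma altD c d : alt (c + d) = alt c + alt d.
Proof. exact: raddfD. Qed.

Lemma altN c : alt (- c) = - alt c.
Proof. exact: raddfN. Qed.

Lemma alt0 : alt 0 = 0.
Proof. exact: raddf0. Qed.

Lemma alt_inj : injective alt.
Proof. by move=> c d /ffunP/(_ 1%g); rewrite !ffunE odd_perm1 !mulr1. Qed.

(** Right multiplication by a transposition changes the sign, and transpositions
    generate. *)
Lemma skewE a : (forall p q : 'I_r, p != q -> a * (1 + grp K (tperm p q)) = 0) ->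
  a = alt (a 1%g).
Proof.
move=> h; apply/ffunP => g; rewrite ffunE; have [ts -> dts] := prod_tpermP g.
elim: ts dts => [|[p q] ts IH] /=; first by rewrite big_nil odd_perm1 mulr1.
case/andP => pq dts; rewrite big_cons odd_permM odd_tperm pq /= signrN.
have := congr1 (fun b : grpalg K r => b (\prod_(t <- ts) tperm t.1 t.2)%g) (h p q pq).
rewrite mulrDr mulr1 [LHS]ffunE grpalg_mulgrpE [RHS]ffunE tpermV.
move/eqP; rewrite addrC addr_eq0 => /eqP ->.
by rewrite IH // mulrN.
Qed.

End GroupAlgebra.

Section Action.
Variables (m n r : nat) (K : comNzRingType).
Local Notation tix := (tix m n r).
Local Notation sgx := (@sgn_exp m n r).
Local Notation P := (@perm_act m n r K).
Implicit Types (I J L : tix) (A B : tmx m n r K) (a : grpalg K r).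

Lemma sact_grp s : sact m n (grp K s) = P s.
Proof.
rewrite /sact (bigD1 s) //= big1 => [|t /negPf ts]; last first.
  by rewrite ffunE ts scale0r.
by rewrite ffunE eqxx scale1r addr0.
Qed.

Lemma sactE a I J : tentry (sact m n a) I J =
  \sum_(s : 'S_r | I == perm_tix s J) a s * (-1) ^+ sgx s J.
Proof.
rewrite /tentry summxE [RHS]big_mkcond; apply: eq_bigr => s _.
rewrite mxE -/(tentry _ I J) tmx_ofE; case: ifP; by rewrite ?mulr0.
Qed.

(** The stabiliser of a word acts on its basis vector by a character; this is the
    sum of the stabiliser weighted by that character. *)
Definition stab_sum J : grpalg K r :=
  [ffun h => if perm_tix h J == J then (-1) ^+ sgx h J else 0].

(** The column of J in the matrix of a, seen as a function on the group rather
    than on the orbit of J. *)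
Lemma mul_stab_sum a J g :
  (a * stab_sum J) g = (-1) ^+ sgx g J * tentry (sact m n a) (perm_tix g J) J.
Proof.
rewrite grpalg_mulE sactE mulr_sumr [RHS]big_mkcond; apply: eq_bigr => s _.
rewrite ffunE perm_tixM -(inj_eq (@perm_tix_inj m n r s)) perm_tixVK.
case: eqP => E; last by rewrite mulr0.
rewrite mulrCA; congr (_ * _).
rewrite -signr_odd odd_sgn_expM E odd_sgn_expV signr_addb !signr_odd.
by rewrite mulrC.
Qed.

(** The symmetric group permutes an orbit of words transitively up to signs. *)
Lemma sact_eval_exists A J :
  (forall I, tentry A I J != 0 -> exists s, I = perm_tix s J) ->
  exists a, forall I, tentry (sact m n a) I J = tentry A I J.
Proof.
move=> h.
(* rep I is one chosen element that moves J to I, and only these carry weight. *)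
pose rep I := odflt 1%g [pick s | I == perm_tix s J].
exists [ffun s => if rep (perm_tix s J) == s
                  then tentry A (perm_tix s J) J * (-1) ^+ sgx s J else 0].
move=> I; rewrite sactE.
have [/h[s0 Is0]|] := boolP (tentry A I J != 0); last first.
  rewrite negbK => /eqP A0; rewrite A0 big1 // => s /eqP E.
  by rewrite ffunE -E A0 mul0r if_same mul0r.
have Irep : I = perm_tix (rep I) J.
  by rewrite /rep; case: pickP => [s /eqP //|/(_ s0)]; rewrite Is0 eqxx.
rewrite (bigD1 (rep I)) /=; last by rewrite -Irep.
rewrite big1 ?addr0 => [|s /andP[/eqP E /negPf sr]]; last first.
  by rewrite ffunE -E eq_sym sr mul0r.
by rewrite ffunE -Irep eqxx -mulrA -expr2 sqrr_sign mulr1.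
Qed.

End Action.

Section PermOfMult.
Variables (m n r : nat).

(** Words with the same content are anagrams. *)
Lemma mult_perm_tix (I J : tix m n r) :
  (forall i, mult i I = mult i J) -> exists s, I = perm_tix s J.
Proof.
move=> h; pose w (L : tix m n r) : r.-tuple _ := [tuple L q | q < r].
have wE (L : tix m n r) i : count_mem i (w L) = mult i L.
  rewrite /= count_map /mult cardE size_filter -enumT; exact: eq_count.
have /tuple_permP[s E] : perm_eq (w I) (w J).
  by apply/allP => i _ /=; rewrite !wE h.
exists s^-1%g; apply/ffunP => q; rewrite ffunE invgK.
have : tnth (w I) q = tnth [tuple tnth (w J) (s i) | i < r] q.
  by congr tnth; apply: val_inj.
by rewrite !tnth_mktuple.
Qed.

Lemma sum_mult (I : tix m n r) : (\sum_i mult i I = r)%N.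
Proof.
rewrite -[RHS]card_ord -sum1_card (partition_big (fun q => I q) predT) //=.
by apply: eq_bigr => i _; rewrite sum1_card /mult; apply: eq_card => q.
Qed.
End PermOfMult.

Section Image.
Variables (m n r : nat) (K : comNzRingType).
Local Notation sact := (@sact m n r K).
Local Notation P := (@perm_act m n r K).
Implicit Types (a b : grpalg K r) (A B : tmx m n r K).

Lemma sactM a b : sact (a * b) = sact a *m sact b.
Proof. exact: rmorphM. Qed.
Lemma sactD a b : sact (a + b) = sact a + sact b.
Proof. exact: rmorphD. Qed.
Lemma sactN a : sact (- a) = - sact a.
Proof. exact: rmorphN. Qed.
Lemma sact0 : sact 0 = 0.
Proof. exact: rmorph0. Qed.
Lemma sact1 : sact 1 = 1%:M.
Proof. exact: rmorph1. Qed.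

(** The group algebra carries no module structure, hence this ad hoc scaling. *)
Definition gscale (c : K) a : grpalg K r := [ffun s => c * a s].

Lemma sactZ c a : sact (gscale c a) = c *: sact a.
Proof.
by rewrite /sact scaler_sumr; apply: eq_bigr => s _; rewrite ffunE scalerA.
Qed.

Definition in_image A := exists a, sact a = A.

Lemma in_imageD A B : in_image A -> in_image B -> in_image (A + B).
Proof. by case=> a <- [b <-]; exists (a + b); rewrite sactD. Qed.
Lemma in_imageN A : in_image A -> in_image (- A).
Proof. by case=> a <-; exists (- a); rewrite sactN. Qed.
Lemma in_imageB A B : in_image A -> in_image B -> in_image (A - B).
Proof. by move=> hA hB; apply/in_imageD/in_imageN. Qed.
Lemma in_imageM A B : in_image A -> in_image B -> in_image (A *m B).
Proof. by case=> a <- [b <-]; exists (a * b); rewrite sactM. Qed.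
Lemma in_imageZ c A : in_image A -> in_image (c *: A).
Proof. by case=> a <-; exists (gscale c a); rewrite sactZ. Qed.
Lemma in_image0 : in_image 0.
Proof. by exists 0; rewrite sact0. Qed.
Lemma in_image1 : in_image 1%:M.
Proof. by exists 1; rewrite sact1. Qed.
Lemma in_image_perm s : in_image (P s).
Proof. by exists (grp K s); rewrite sact_grp. Qed.

Lemma perm_act_tr s : (P s)^T = P s^-1.
Proof.
apply: tmxP => I J; rewrite /tentry mxE -!/(tentry _ _ _) !tmx_ofE.
have -> : (J == perm_tix s I) = (I == perm_tix s^-1 J).
  by apply/eqP/eqP => ->; rewrite ?perm_tixK ?perm_tixVK.
case: eqP => // ->; rewrite -signr_odd -[in RHS]signr_odd.
by have := odd_sgn_expV s^-1 J; rewrite invgK => ->.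
Qed.

Lemma in_image_tr A : in_image A -> in_image A^T.
Proof.
case=> a <-; rewrite /sact linear_sum /=.
elim/big_rec: _ => [|s B _]; first exact: in_image0.
move=> hB; apply: in_imageD => //.
by rewrite linearZ /= perm_act_tr; apply/in_imageZ/in_image_perm.
Qed.
End Image.

(** * Sums over the cosets of a 3-cycle *)

(** For a 3-cycle c through x, this selects one element in each coset
    {g, c g, c c g}: the one that takes its least value on the cycle at x. *)
Definition min3 r (c : 'S_r) (x : 'I_r) (g : 'S_r) : bool :=
  (g x < g (c x))%N && (g x < g (c (c x)))%N.

Lemma min3_transversal r (c : 'S_r) x (g : 'S_r) : c x != x -> c (c (c x)) = x ->
  (min3 c x g + min3 c x (c * g) + min3 c x (c * c * g) = 1)%N.
Proof.
move=> cx ccc; rewrite /min3 !permM !ccc.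
have ccx : c (c x) != x by apply: contraNneq cx => E; rewrite -{2}ccc E.
have n1 : (g x != g (c x) :> nat) by rewrite val_eqE (inj_eq perm_inj) eq_sym.
have n2 : (g x != g (c (c x)) :> nat) by rewrite val_eqE (inj_eq perm_inj) eq_sym.
have n3 : (g (c x) != g (c (c x)) :> nat).
  by rewrite val_eqE !(inj_eq perm_inj) eq_sym.
move: (nat_of_ord (g x)) (nat_of_ord (g (c x))) (nat_of_ord (g (c (c x)))) n1 n2 n3 => a b d.
by case: (ltngtP a b); case: (ltngtP a d); case: (ltngtP b d) => //=; lia.
Qed.

Lemma sum_cycle3 (V : nmodType) r (c : 'S_r) x (F : 'S_r -> V) :
  c x != x -> c (c (c x)) = x -> (forall g, F (c * g)%g = F g) ->
  \sum_g F g = (\sum_(g | min3 c x g) F g) *+ 3.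
Proof.
move=> cx ccc Fc.
transitivity (\sum_g (F g *+ min3 c x g + F (c * g)%g *+ min3 c x (c * g)
     + F (c * c * g)%g *+ min3 c x (c * c * g))).
  apply: eq_bigr => g _; rewrite -[(c * c * g)%g]mulgA !Fc -!mulrnDr.
  by rewrite mulgA min3_transversal.
have re z : \sum_g F (z * g)%g *+ min3 c x (z * g) = \sum_(g | min3 c x g) F g.
  rewrite [RHS]big_mkcond [RHS](reindex_inj (mulgI z)) /=.
  by apply: eq_bigr => g _; case: ifP.
rewrite !big_split /= !re mulrS mulr2n addrA.
by congr (_ + _ + _); rewrite -[RHS](re 1%g); apply: eq_bigr => g _; rewrite mul1g.
Qed.

(** * Arithmetic modulo 3 *)

Section CharThree.
Variables (k : fieldType) (char_k : 3%N \in [pchar k]).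

Lemma char3_natr_eq (a b : nat) : a%:R = b%:R :> k -> a = b %[mod 3].
Proof.
wlog ab : a b / (a <= b)%N => [wl E|].
  by case: (leqP a b) => [/wl|/ltnW/wl h]; [exact | apply/esym/h].
move=> E; apply/esym/eqP; rewrite eqn_mod_dvd // (dvdn_pcharf char_k).
by rewrite natrB // E subrr.
Qed.

Lemma char3_two_neq0 : 2%:R != 0 :> k.
Proof. by rewrite -(dvdn_pcharf char_k). Qed.

Lemma char3_reg2 (x : k) : x *+ 2 = 0 -> x = 0.
Proof.
by move/eqP; rewrite -mulr_natl mulf_eq0 (negPf char3_two_neq0) => /eqP.
Qed.

Lemma char3_nat0 : 3%:R = 0 :> k.
Proof. by apply/eqP; rewrite -(dvdn_pcharf char_k). Qed.

End CharThree.

Section ThreeZero.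
Variables (R : pzRingType) (three : 3%:R = 0 :> R).

Lemma char3_eqN (x : R) : - x = x -> x = 0.
Proof.
move=> E; have h2 : x *+ 2 = 0 by rewrite mulr2n -{1}E addNr.
have : x *+ 3 = 0 by rewrite -mulr_natl three mul0r.
by rewrite mulrSr h2 add0r.
Qed.

Lemma char3_forty : 40%:R = 1 :> R.
Proof. by rewrite -[40%N]/(1 + 3 * 13)%N natrD natrM three mul0r addr0. Qed.

End ThreeZero.

(** Multiplicities are preserved modulo 3.  If those of J are below 3, they are
    lower bounds for those of I, and both add up to r. *)
Lemma lie_comm_orbit (k : fieldType) (char_k : 3%N \in [pchar k]) m n r
    (A : tmx m n r k) I J :
  lie_comm A -> (forall i, (mult i J < 3)%N) -> tentry A I J != 0 ->
  exists s, I = perm_tix s J.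
Proof.
move=> cA J3 /(lie_comm_mult cA) h; apply: mult_perm_tix => i.
have le_mult j : (mult j J <= mult j I)%N.
  by rewrite -(modn_small (J3 j)) -(char3_natr_eq char_k (h j)) leq_mod.
have /leqif_sum/= [_] : forall j, xpredT j -> (mult j J <= mult j I ?= iff (mult j J == mult j I))%N.
  by move=> j _; apply: leqif_eq.
by rewrite !sum_mult eqxx => /esym/forallP/(_ i)/eqP.
Qed.

(** * The kernel of the group algebra for 2|1 and five factors *)

Section Words.

Definition la : 'I_(2 + 1) := @Ordinal 3 0 isT.
Definition lb : 'I_(2 + 1) := @Ordinal 3 1 isT.
Definition lc : 'I_(2 + 1) := @Ordinal 3 2 isT.

Definition p0 : 'I_5 := @Ordinal 5 0 isT.
Definition p1 : 'I_5 := @Ordinal 5 1 isT.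
Definition p2 : 'I_5 := @Ordinal 5 2 isT.
Definition p3 : 'I_5 := @Ordinal 5 3 isT.
Definition p4 : 'I_5 := @Ordinal 5 4 isT.

Local Notation tix := (tix 2 1 5).
Local Notation sgx := (@sgn_exp 2 1 5).

(** Words that are constant on the blocks 01, 23 and 4 of positions. *)
Definition word (f : nat -> 'I_(2 + 1)) : tix := [ffun q : 'I_5 => f (q./2)%N].
Definition Jaabbc : tix := word (fun e => nth la [:: la; lb; lc] e).
Definition Jaaccb : tix := word (fun e => nth la [:: la; lc; lb] e).

Lemma letter_ind (Q : 'I_(2 + 1) -> Prop) : Q la -> Q lb -> Q lc -> forall i, Q i.
Proof.
move=> q0 q1 q2 [[|[|[|//]]] h].
- by rewrite (_ : Ordinal h = la) //; apply: val_inj.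
- by rewrite (_ : Ordinal h = lb) //; apply: val_inj.
- by rewrite (_ : Ordinal h = lc) //; apply: val_inj.
Qed.

Lemma sum_letters (F : 'I_(2 + 1) -> nat) : (\sum_i F i = F la + F lb + F lc)%N.
Proof.
rewrite !big_ord_recl big_ord0 addn0 addnA.
by congr (F _ + F _ + F _)%N; apply: val_inj.
Qed.

Lemma I5_ind (Q : 'I_5 -> Prop) : Q p0 -> Q p1 -> Q p2 -> Q p3 -> Q p4 -> forall q, Q q.
Proof.
move=> q0 q1 q2 q3 q4 [[|[|[|[|[|//]]]]] h].
- by rewrite (_ : Ordinal h = p0) //; apply: val_inj.
- by rewrite (_ : Ordinal h = p1) //; apply: val_inj.
- by rewrite (_ : Ordinal h = p2) //; apply: val_inj.
- by rewrite (_ : Ordinal h = p3) //; apply: val_inj.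
- by rewrite (_ : Ordinal h = p4) //; apply: val_inj.
Qed.

Definition blocks (h : 'S_5) := [forall q, (h q)./2 == q./2].

Lemma perm_tix_word (f : nat -> 'I_(2 + 1)) h : {in gtn 3 &, injective f} ->
  (perm_tix h (word f) == word f) = blocks h.
Proof.
move=> fI; have lt3 (q : 'I_5) : (q./2 < 3)%N by move: q; apply: I5_ind.
apply/eqP/forallP => [E q|E].
  have := congr1 (fun J : tix => J (h q)) E; rewrite /= perm_tixE !ffunE.
  by move=> /fI -> //; apply: lt3.
apply/ffunP => q; rewrite -(permKV h q) perm_tixE !ffunE.
by rewrite (eqP (E _)).
Qed.

Lemma Jaabbc_inj : {in gtn 3 &, injective (nth la [:: la; lb; lc])}.
Proof. by move=> [|[|[|//]]] [|[|[|//]]]. Qed.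

Lemma Jaaccb_inj : {in gtn 3 &, injective (nth la [:: la; lc; lb])}.
Proof. by move=> [|[|[|//]]] [|[|[|//]]]. Qed.

Lemma eq_word f (p q : 'I_5) : {in gtn 3 &, injective f} ->
  (word f p == word f q) = (p./2 == q./2)%N.
Proof.
move=> fI; have lt3 (x : 'I_5) : (x./2 < 3)%N by move: x; apply: I5_ind.
by rewrite !ffunE; apply/eqP/eqP => [/fI->|->] //; apply: lt3.
Qed.

Lemma mult_word f i : {in gtn 3 &, injective f} -> (mult i (word f) < 3)%N.
Proof.
move=> fI; rewrite ltnNge; apply/negP => /card_gt2P[p [q [r []]]].
rewrite !inE => -[/eqP <- pq pr]; move: pq pr; rewrite !(eq_word _ _ fI).
by move=> qp rp [pq qr pr]; move: p q r qp rp pq qr pr; do 3!apply: I5_ind.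
Qed.

Lemma sgn_exp_Jaabbc h : sgx h Jaabbc = 0%N.
Proof.
apply/eqP; rewrite cards_eq0; apply/eqP/setP => -[u v]; rewrite !inE /= !ffunE.
apply/negP => /and4P[uv _]; move: u v uv.
by apply: I5_ind; apply: I5_ind.
Qed.

Lemma sgn_exp_Jaaccb h : sgx h Jaaccb = (h p3 < h p2)%N.
Proof.
rewrite /sgn_exp (_ : [set u | _] = if (h p3 < h p2)%N then [set (p2, p3)] else set0).
  by case: (h p3 < h p2)%N; rewrite ?cards1 ?cards0.
apply/setP => -[u v]; rewrite !inE /= !ffunE.
move: u v; do 2!apply: I5_ind; rewrite /= ?andbF //; by case: (h p3 < h p2)%N; rewrite ?inE.
Qed.

Lemma blocks_id_or_swap h : blocks h ->
  (h p0 = p0 /\ h p1 = p1 \/ h p0 = p1 /\ h p1 = p0) /\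
  (h p2 = p2 /\ h p3 = p3 \/ h p2 = p3 /\ h p3 = p2) /\ h p4 = p4.
Proof.
move=> /forallP hb.
have h01 : h p0 <> h p1 by move/perm_inj.
have h23 : h p2 <> h p3 by move/perm_inj.
have := (hb p0, hb p1, hb p2, hb p3, hb p4) => -[[[[]]]].
elim/I5_ind: (h p4) => //= b0 b1 b2 b3 _; split; last split=> //.
- move: b0 b1 h01; elim/I5_ind: (h p0) => // _; elim/I5_ind: (h p1) => // _; by [left|right|].
- move: b2 b3 h23; elim/I5_ind: (h p2) => // _; elim/I5_ind: (h p3) => // _; by [left|right|].
Qed.

(** The stabiliser of both words is generated by the transpositions of 0, 1 and
    of 2, 3.  Exchanging 2 and 3 has sign 1 on aabbc, where both letters are b,
    and sign -1 on aaccb, so these terms cancel. *)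
Lemma stab_sumE (K : comNzRingType) :
  stab_sum K Jaabbc + stab_sum K Jaaccb = (1 + grp K (tperm p0 p1)) *+ 2.
Proof.
apply/ffunP => h.
rewrite ffunE [stab_sum _ _ _]ffunE [stab_sum K Jaaccb h]ffunE ffunMnE.
have -> : ((1 + grp K (tperm p0 p1)) h = (h == 1%g)%:R + (h == tperm p0 p1)%:R).
  by rewrite ffunE [in X in X + _]ffunE ffunE.
rewrite !perm_tix_word; [|exact: Jaaccb_inj|exact: Jaabbc_inj].
rewrite sgn_exp_Jaabbc sgn_exp_Jaaccb.
have t01 q : q != p0 -> q != p1 -> tperm p0 p1 q = q by move=> *; rewrite tpermD // eq_sym.
case: ifPn => [/blocks_id_or_swap[h01 [h23 h4]]|nb]; last first.
  have h1 : h != 1%g.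
    by apply: contraNneq nb => ->; apply/forallP => q; rewrite perm1.
  have ht : h != tperm p0 p1.
    by apply: contraNneq nb => ->; apply/forallP => q; case: tpermP => // ->.
  by rewrite (negPf h1) (negPf ht) !addr0 mul0rn.
case: h23 => [] [h2 h3]; rewrite h2 h3 /= ?expr0 ?expr1; last first.
  have h1 : h != 1%g by apply/eqP => E; move: h2; rewrite E perm1.
  have ht : h != tperm p0 p1 by apply/eqP => E; move: h2; rewrite E t01.
  by rewrite (negPf h1) (negPf ht) !addr0 mul0rn subrr.
case: h01 => [] [hp0 hp1].
  have -> : h = 1%g.
    by apply/permP; apply: I5_ind; rewrite ?perm1.
  rewrite eqxx (_ : (1%g == tperm p0 p1) = false) ?addr0 ?mulr2n //.
  by apply/negP => /eqP/permP/(_ p0); rewrite perm1 tpermL.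
have -> : h = tperm p0 p1.
  by apply/permP; apply: I5_ind; rewrite ?tpermL ?tpermR // t01.
rewrite eqxx (_ : (tperm p0 p1 == 1%g) = false) ?add0r ?mulr2n //.
by apply/negP => /eqP/permP/(_ p0); rewrite perm1 tpermL.
Qed.

Section Kernel.
Variable K : comNzRingType.

(** The coefficients of a (1 + t) can be read off two columns of its matrix. *)
Lemma two_mul_sym (a : grpalg K 5) g :
  (a * (1 + grp K (tperm p0 p1))) g *+ 2 =
  (-1) ^+ sgx g Jaabbc * tentry (sact 2 1 a) (perm_tix g Jaabbc) Jaabbc +
  (-1) ^+ sgx g Jaaccb * tentry (sact 2 1 a) (perm_tix g Jaaccb) Jaaccb.
Proof.
rewrite -!mul_stab_sum; transitivity ((a * ((1 + grp K (tperm p0 p1)) *+ 2)) g).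
  by rewrite mulrnAr ffunMnE.
by rewrite -stab_sumE mulrDr ffunE.
Qed.

Lemma tperm_conj01 (p q : 'I_5) : p != q ->
  exists u : 'S_5, tperm p q = (tperm p0 p1 ^ u)%g.
Proof.
move=> pq.
have [u [u0 u1]] : exists u : 'S_5, u p0 = p /\ u p1 = q.
  pose v := tperm p0 p; exists (v * tperm (v p1) q)%g; rewrite !permM tpermL tpermL.
  split=> //; rewrite tpermD //; last by rewrite eq_sym.
  by rewrite -[X in _ != X](tpermL p0 p) -/v (inj_eq perm_inj).
by exists u; rewrite tpermJ u0 u1.
Qed.

Hypothesis reg2 : forall x : K, x *+ 2 = 0 -> x = 0.

(** Faithfulness holds up to the alternating element without any assumption on
    3; this is the form that survives in characteristic 3. *)
Lemma sact_ker_alt (a : grpalg K 5) : sact 2 1 a = 0 -> a = alt 5 (a 1%g).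
Proof.
move=> a0; apply: skewE => p q /tperm_conj01[u ->]; rewrite mul_sym_conj.
suff -> : a * grp K u * (1 + grp K (tperm p0 p1)) = 0 by rewrite mul0r.
apply/ffunP => g; rewrite [RHS]ffunE; apply: reg2.
have au : sact 2 1 (a * grp K u) = 0 by rewrite rmorphM /= a0 mul0r.
rewrite two_mul_sym au /tentry.
by rewrite !mxE !mulr0 addr0.
Qed.

End Kernel.

End Words.

(** * Symmetrised equivariant maps come from the group algebra *)

Section SymmetriseWord.
Variables (k : fieldType) (char_k : 3%N \in [pchar k]).
Local Notation tix := (tix 2 1 5).
Local Notation tmx := (tmx 2 1 5 k).
Local Notation P := (@perm_act 2 1 5 k).
Local Notation sact := (@sact 2 1 5 k).
Local Notation in_image := (@in_image 2 1 5 k).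
Implicit Types (A B : tmx) (I J : tix).

(** An element of the group algebra agrees with A on the word, and
    [lie_comm_vanish] applies to the difference multiplied by the symmetriser of
    the two blocks of size 2, since 1 and 2 are invertible. *)
Lemma symmetrize_in_image (f : nat -> 'I_(2 + 1)) A :
  {in gtn 3 &, injective f} -> odd_ix (f 0%N) = false -> lie_comm A ->
  in_image (A *m ((1%:M + P (tperm p0 p1)) *m
     (1%:M + (-1) ^+ odd_ix (f 1%N) *: P (tperm p2 p3)))).
Proof.
move=> fI f0 cA; have wE p q := eq_word p q fI.
have [a ha] : exists a, forall I, tentry (sact a) I (word f) = tentry A I (word f).
  apply: sact_eval_exists => I; apply: (lie_comm_orbit char_k cA) => i.
  exact: mult_word.
set e := _ ^+ _; set X := (_ + _) *m _.
have ee : e * e = 1 by rewrite -expr2 sqrr_sign.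
have imX : in_image X.
  rewrite /X; apply: in_imageM; apply: in_imageD; try exact: in_image1.
    exact: in_image_perm.
  exact/in_imageZ/in_image_perm.
have [x xX] := imX.
(* The block symmetrisers commute, so X absorbs both transpositions on the right. *)
have tC : (tperm p0 p1 * tperm p2 p3 = tperm p2 p3 * tperm p0 p1)%g.
  by rewrite conjgC tpermJ !tpermD.
have tt (p q : 'I_5) : P (tperm p q) *m P (tperm p q) = 1%:M.
  by rewrite -perm_actM tperm2 perm_act1.
have X23 : X *m P (tperm p2 p3) = e *: X.
  rewrite /X -mulmxA scalemxAr; congr (_ *m _).
  by rewrite mulmxDl mul1mx -scalemxAl tt scalerDr scalerA ee scale1r addrC.
have X01 : X *m P (tperm p0 p1) = X.
  rewrite /X -mulmxA (_ : _ *m P _ = P (tperm p0 p1) *m (1%:M + e *: P (tperm p2 p3))).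
    by rewrite mulmxA mulmxDl mul1mx tt [P _ + _]addrC.
  rewrite mulmxDl mulmxDr mulmx1 mul1mx -scalemxAl -scalemxAr.
  by rewrite -!perm_actM tC.
suff : (A - sact a) *m X = 0.
  by rewrite mulmxBl => /subr0_eq ->; exists (a * x); rewrite sactM xX.
have c0 : forall I, tentry (A - sact a) I (word f) = 0.
  by move=> I; rewrite /tentry !mxE -!/(tentry _ _ _) ha subrr.
apply: (@lie_comm_vanish _ _ _ _ (word f)).
- move=> p c /andP[c_gt0 /leq_trans/(_ (mult_word _ fI)) cle].
  by case: c c_gt0 cle => [|[|[|//]]] // _ _; [exact: oner_neq0|exact: char3_two_neq0].
- apply: lie_commM; last by rewrite -xX; apply: lie_comm_sact.
  by apply: lie_commD => //; rewrite -sactN; apply: lie_comm_sact.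
- move=> p q npq /eqP; rewrite wE -mulmxA => pq.
  have [[-> <-]|[-> <-]] : ((word f p = f 0%N) /\ tperm p0 p1 = tperm p q) \/
       ((word f p = f 1%N) /\ tperm p2 p3 = tperm p q).
    rewrite ffunE; move: p q npq pq; do 2!apply: I5_ind => //;
      by [left|right|left; rewrite tpermC|right; rewrite tpermC].
    by rewrite X01 f0 expr0 scale1r.
  by rewrite X23 -/e -scalemxAr.
- move=> I; rewrite /X.
  have stab (t : 'S_5) (B : tmx) : perm_tix t (word f) = word f ->
     (forall L, tentry B L (word f) = 0) ->
     (forall L, tentry (B *m P t) L (word f) = 0).
    by move=> tw B0 L; rewrite tentry_mul_perm tw B0 mul0r.
  have add0 (B C : tmx) : (forall L, tentry B L (word f) = 0) ->
     (forall L, tentry C L (word f) = 0) -> (forall L, tentry (B + C) L (word f) = 0).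
    by move=> hB hC L; rewrite /tentry mxE -!/(tentry _ _ _) hB hC addr0.
  have sc0 (B : tmx) c : (forall L, tentry B L (word f) = 0) ->
      (forall L, tentry (c *: B) L (word f) = 0).
    by move=> hB L; rewrite /tentry mxE -!/(tentry _ _ _) hB mulr0.
  have s01 : perm_tix (tperm p0 p1) (word f) = word f.
    by apply: perm_tix_tperm; apply/eqP; rewrite wE.
  have s23 : perm_tix (tperm p2 p3) (word f) = word f.
    by apply: perm_tix_tperm; apply/eqP; rewrite wE.
  rewrite mulmxA.
  move: I; rewrite [_ *m (_ + _ *: _)]mulmxDr mulmx1 -scalemxAr.
  have h : forall L, tentry ((A - sact a) *m (1%:M + P (tperm p0 p1))) L (word f) = 0.
    by rewrite mulmxDr mulmx1; apply: (add0) => //; apply: stab.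
  by apply: (add0) => //; apply: sc0; apply: stab.
Qed.

End SymmetriseWord.

Section Symmetrise.
Variables (k : fieldType) (char_k : 3%N \in [pchar k]).
Local Notation tmx := (tmx 2 1 5 k).
Local Notation P := (@perm_act 2 1 5 k).
Local Notation sact := (@sact 2 1 5 k).
Local Notation in_image := (@in_image 2 1 5 k).
Implicit Types A B : tmx.

Let two_neq0 := char3_two_neq0 char_k.

Lemma half_double A : 2%:R^-1 *: (A + A) = A.
Proof. by rewrite -mulr2n -scaler_nat scalerA mulVf // scale1r. Qed.

(** On the positions 2, 3 the words aabbc and aaccb give the symmetriser 1 + u
    and the antisymmetriser 1 - u, whose sum is 2. *)
Lemma sym01_in_image A : lie_comm A ->
  in_image (A *m (1%:M + P (tperm p0 p1))).
Proof.
move=> cA.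
have := symmetrize_in_image char_k Jaabbc_inj (erefl _) cA.
have := symmetrize_in_image char_k Jaaccb_inj (erefl _) cA.
rewrite /= expr0 expr1 scale1r scaleN1r => im2 im1.
rewrite -[A *m _]half_double; apply: in_imageZ.
have := in_imageD im1 im2; rewrite -mulmxDr -mulmxDr addrACA subrr addr0.
by rewrite mulmxDr mulmx1 mulmxDr.
Qed.

Lemma sym_in_image A (p q : 'I_5) : p != q -> lie_comm A ->
  in_image (A *m (1%:M + P (tperm p q))).
Proof.
move=> pq cA; have [u ->] := tperm_conj01 pq.
rewrite /conjg !perm_actM.
have -> : A *m (1%:M + P u *m P (tperm p0 p1) *m P u^-1) =
    (A *m P u) *m (1%:M + P (tperm p0 p1)) *m P u^-1.
  rewrite !mulmxDr !mulmx1 mulmxDl -!mulmxA; congr (_ + _).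
  by rewrite -perm_actM mulVg perm_act1 mulmx1.
apply: in_imageM; last exact: in_image_perm.
by apply: sym01_in_image; apply: lie_commM => //; apply: lie_comm_perm.
Qed.

(** Modulo the image of the group algebra, right multiplication acts on the
    centralizer through the sign character. *)
Lemma sign_in_image A (g : 'S_5) : lie_comm A ->
  in_image (A *m P g - (-1) ^+ g *: A).
Proof.
move=> cA; have [ts -> dts] := prod_tpermP g.
elim: ts dts => [_|[p q] ts IH] /=.
  by rewrite big_nil odd_perm1 expr0 scale1r perm_act1 mulmx1 subrr; apply: in_image0.
case/andP => pq /IH {}IH; rewrite big_cons odd_permM odd_tperm pq /= signrN scaleNr opprK.
set g' := (\prod_(_ <- _) _)%g in IH *.
have h : in_image (A *m P g' *m (1%:M + P (tperm p q))).
  by apply: sym_in_image => //; apply: lie_commM => //; apply: lie_comm_perm.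
have := in_imageB h IH; rewrite mulmxDr mulmx1 perm_actM mulmxA.
by rewrite opprB [_ *m _ + _]addrC -addrA [_ + (_ - _)]addrCA subrr addr0.
Qed.

End Symmetrise.

(** * Invariance under a 3-cycle *)

(** The cycle p0 -> p1 -> p2 -> p0. *)
Definition c012 : 'S_5 := (tperm p1 p2 * tperm p0 p1)%g.

Lemma c012E : [/\ c012 p0 = p1, c012 p1 = p2, c012 p2 = p0, c012 p3 = p3 & c012 p4 = p4].
Proof.
rewrite /c012 !permM; split; rewrite ?tpermL ?tpermR //.
- by rewrite [tperm p1 p2 p0]tpermD // tpermL.
- by rewrite tpermD.
- by rewrite [tperm p1 p2 p3]tpermD // tpermD.
- by rewrite [tperm p1 p2 p4]tpermD // tpermD.
Qed.

Lemma c012V : (c012^-1 = c012 * c012)%g.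
Proof.
apply: (mulgI c012); rewrite mulgV; apply/permP.
move: c012 c012E => z [e0 e1 e2 e3 e4].
by apply: I5_ind; rewrite !permM perm1 !(e0, e1, e2, e3, e4).
Qed.

Lemma odd_c012 : odd_perm c012 = false.
Proof. by rewrite /c012 odd_permM !odd_tperm. Qed.

Section CycleCorrection.
Variables (k : fieldType) (char_k : 3%N \in [pchar k]).
Local Notation tmx := (tmx 2 1 5 k).
Local Notation P := (@perm_act 2 1 5 k).
Local Notation sact := (@sact 2 1 5 k).
Local Notation in_image := (@in_image 2 1 5 k).
Local Notation grp := (@grp k 5).
Local Notation alt := (@alt k 5).
Implicit Types A B : tmx.

Let reg2 := char3_reg2 char_k.

Let t := grp (tperm p0 p1).
Let t' := grp (tperm p1 p2).
Let c := grp c012.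

Lemma tt'E : t * t' = c.
Proof. by rewrite /t /t' grpM. Qed.

Lemma ccc1 : c * c * c = 1.
Proof.
rewrite /c !grpM (_ : (_ * _)%g = 1%g) //; apply/permP.
move: c012 c012E => z [e0 e1 e2 e3 e4].
by apply: I5_ind; rewrite !permM perm1 !(e0, e1, e2, e3, e4).
Qed.

Lemma tct : t * c = c * c * t.
Proof.
rewrite /t /c !grpM; congr grp; apply/permP.
move: c012 c012E => z [e0 e1 e2 e3 e4].
have tz q : q != p0 -> q != p1 -> tperm p0 p1 q = q by move=> *; rewrite tpermD // eq_sym.
apply: I5_ind; rewrite !permM ?(e0, e1, e2, e3, e4) ?tpermL ?tpermR;
  by rewrite ?tpermL ?tpermR ?tz ?(e0, e1, e2, e3, e4).
Qed.

Lemma grpalgDE (a b : grpalg k 5) g : (a + b) g = a g + b g.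
Proof. by rewrite ffunE. Qed.

Lemma grpalgNE (a : grpalg k 5) g : (- a) g = - a g.
Proof. by rewrite ffunE. Qed.

(** The group algebra is free over that of the subgroup generated by c, where the
    kernel of 1 + c + c^2 is generated by 1 - c.  Cutting s by the transversal
    [min3] writes it as a0 + a1 c + a2 c^2 with a0 + a1 + a2 = 0. *)
Lemma norm_ker (s : grpalg k 5) : s * (1 + c + c * c) = 0 -> exists s', s = s' * (1 - c).
Proof.
move=> sN.
pose chi (g : 'S_5) : k := (min3 c012 p0 g)%:R.
pose a0 : grpalg k 5 := [ffun g => chi g * s g].
pose a1 : grpalg k 5 := [ffun g => chi g * (s * (c * c)) g].
pose a2 : grpalg k 5 := [ffun g => chi g * (s * c) g].
have aE (f : 'S_5 -> k) g : [ffun x => chi x * f x] g = chi g * f g by rewrite ffunE.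
have a012 : a0 = - a1 - a2.
  apply/ffunP => g; have := congr1 (fun a : grpalg k 5 => a g) sN.
  rewrite /= !mulrDr mulr1 !grpalgDE [RHS]ffunE => /eqP.
  rewrite -addrA addr_eq0 => /eqP E.
  by rewrite grpalgNE grpalgNE !aE E mulrN mulrDr -opprD addrC.
have sE : s = a0 + a1 * c + a2 * (c * c).
  apply/ffunP => g; rewrite !grpalgDE.
  have -> : (a1 * c) g = a1 (c012^-1 * g)%g by rewrite grpalg_mulgrpE.
  have -> : (a2 * (c * c)) g = a2 (c012 * g)%g.
    by rewrite /c grpM grpalg_mulgrpE -c012V invgK.
  rewrite !aE.
  have -> : (s * (c * c)) (c012^-1 * g)%g = s g.
    by rewrite /c grpM grpalg_mulgrpE -c012V invgK mulKVg.
  have -> : (s * c) (c012 * g)%g = s g by rewrite /c grpalg_mulgrpE mulKg.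
  have [e0 e1 e2 _ _] := c012E.
  have := @min3_transversal _ c012 p0 g; rewrite e0 e1 e2 => /(_ isT erefl).
  rewrite -c012V addnAC => /(congr1 (fun x => x%:R : k)) E.
  by rewrite -!mulrDl /chi -!natrD E mul1r.
exists (- (a1 + a2 * (1 + c))).
rewrite {1}sE a012 mulNr mulrDl -mulrA.
have -> : (1 + c) * (1 - c) = 1 - c * c.
  by rewrite mulrDl mul1r mulrBr mulr1 addrA addrNK.
rewrite !mulrBr !mulr1 !opprD !opprK.
by rewrite addrACA addrA addrAC -!addrA; congr (_ + _); rewrite addrCA.
Qed.

(** Since 1 - c = (1 + t) - t (1 + t'), the map A (1 - c) comes from some s, and
    s N is a multiple lam n of the alternating element, for N = 1 + c + c^2.  This
    lam is the obstruction; conjugation by t, on which A changes sign, maps it to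
    - lam, so that it vanishes and s = s' (1 - c) by [norm_ker]. *)
Lemma cycle_fix A : lie_comm A -> A *m P (tperm p0 p1) = - A ->
  exists s', (A - sact s') *m P c012 = A - sact s'.
Proof.
move=> cA At.
have tE : P (tperm p0 p1) = sact t by rewrite sact_grp.
have cE : P c012 = sact c by rewrite sact_grp.
have ct : c * t = t * (c * c).
  by rewrite mulrA tct -[RHS]mulrA tct mulrA [_ * (c * c)]mulrA ccc1 mul1r.
have [s sE] : in_image (A *m sact (1 - c)).
  have -> : A *m sact (1 - c) = A *m (1%:M + P (tperm p0 p1))
     - A *m P (tperm p0 p1) *m (1%:M + P (tperm p1 p2)).
    rewrite -(sact_grp 2 1 k (tperm p1 p2)) -/t' tE -sact1 -!sactD.
    rewrite -[A *m _ *m _]mulmxA -sactM -mulmxBr -sactN -sactD mulrDr mulr1 tt'E.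
    by rewrite opprD addrA addrK.
  apply: in_imageB; first exact: sym_in_image.
  by apply: sym_in_image => //; apply: lie_commM => //; apply: lie_comm_perm.
have cc1 : (1 - c) * (1 + c + c * c) = 0.
  by rewrite mulrBl mul1r !mulrDr mulr1 mulrA ccc1 [_ + 1]addrC addrA subrr.
set N := 1 + c + c * c in cc1.
(* lam n = s N, since s N acts as A (1 - c) N = 0. *)
have sN : s * N = alt ((s * N) 1%g).
  by apply: (sact_ker_alt reg2); rewrite sactM sE -mulmxA -sactM cc1 sact0 mulmx0.
move: ((s * N) 1%g) sN => lam sN.
(* Both terms act as A (c^2 - 1), by A t = - A. *)
have st : s * t - s * (c * c) = alt ((s * t - s * (c * c)) 1%g).
  apply: (sact_ker_alt reg2); rewrite sactD sactN !sactM sE -!mulmxA -!sactM.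
  have -> : (1 - c) * t = t * (1 - c * c).
    by rewrite mulrBl mul1r mulrBr mulr1 ct.
  have -> : (1 - c) * (c * c) = c * c - 1 by rewrite mulrBl mul1r mulrA ccc1.
  rewrite [sact (t * _)]sactM mulmxA -tE At mulNmx -mulmxN -sactN opprB.
  by rewrite subrr.
move: ((s * t - _) 1%g) st => mu st.
have tN : t * N = N * t.
  by rewrite /N !mulrDr !mulrDl mulr1 mul1r tct ct addrAC.
have ccN : c * (c * N) = N.
  rewrite /N mulrA !mulrDr mulr1 ccc1 [c * c * (c * c)]mulrA ccc1 mul1r.
  by rewrite [c * c + 1]addrC addrAC.
have altc x : alt x * c = alt x by rewrite alt_grp odd_c012 mulr1.
have altN3 x : alt x * N = 0.
  rewrite /N !mulrDr mulr1 mulrA !altc -!altD.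
  rewrite (_ : x + x + x = 3%:R * x); last by ring.
  by rewrite (char3_nat0 char_k) mul0r alt0.
(* Multiplying the last relation by N, which kills n, compares lam with - lam. *)
have lam0 : lam = 0.
  apply: (char3_eqN (char3_nat0 char_k)); apply: (@alt_inj k 5); apply/eqP.
  rewrite -subr_eq0; apply/eqP; rewrite -[RHS](altN3 mu) -st mulrBl -!mulrA tN ccN.
  by rewrite mulrA sN alt_grp odd_tperm /= expr1 mulrN1.
have [s' s'E] : exists s', s = s' * (1 - c).
  by apply: norm_ker; rewrite -/N sN lam0 alt0.
exists s'; apply/eqP; rewrite -subr_eq0 -oppr_eq0 opprB; apply/eqP.
rewrite -[X in X - _](mulmx1 (A - _)) -mulmxBr.
have -> : 1%:M - P c012 = sact (1 - c) by rewrite cE sactD sactN sact1.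
by rewrite mulmxBl -sE -sactM -s'E subrr.
Qed.

End CycleCorrection.

(** * Averaging to a skew map *)

Section Averaging.
Variables (k : fieldType) (char_k : 3%N \in [pchar k]).
Local Notation tmx := (tmx 2 1 5 k).
Local Notation P := (@perm_act 2 1 5 k).
Local Notation sact := (@sact 2 1 5 k).
Local Notation in_image := (@in_image 2 1 5 k).
Implicit Types A B : tmx.

(** Maps that transform by the sign character on the right. *)
Definition rskew A := forall g, A *m P g = (-1) ^+ odd_perm g *: A.

(** The sign-twisted translates of A are constant on the cosets of H and agree
    with A modulo the image of the group algebra, so their mean over the cosets
    is the required map. *)
Lemma average_rskew A (H : {group 'S_5}) : lie_comm A ->
  {in H, forall h, A *m P h = (-1) ^+ odd_perm h *: A} ->
  ~~ (3 %| #|[set: 'S_5] : H|%g)%N ->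
  exists B, [/\ lie_comm B, in_image (A - B) & rskew B].
Proof.
move=> cA AH idx; set n := #|_ : H|%g in idx.
have n0 : n%:R != 0 :> k by rewrite -(dvdn_pcharf char_k).
pose f (g : 'S_5) := (-1) ^+ odd_perm g *: (A *m P g^-1).
have fH h g : h \in H -> f (h * g)%g = f g.
  move=> hH; rewrite /f odd_permM invMg perm_actM mulmxA (AH h^-1%g) ?groupV //.
  by rewrite -scalemxAl odd_permV scalerA signr_addb mulrAC -expr2 sqrr_sign mul1r.
have frep (C : {set 'S_5}) x : C \in rcosets H setT -> x \in C -> f x = f (repr C).
  case/rcosetsP => y _ -> /rcosetP[h hH ->].
  by have /rcosetP[h' h'H ->] := mem_repr_rcoset H y; rewrite !fH.
pose B := \sum_(C in rcosets H [set: 'S_5]) f (repr C).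
have fD g : lie_comm (f g) by apply/lie_commZ/lie_commM => //; apply: lie_comm_perm.
have fI g : in_image (A - f g).
  rewrite -opprB; apply: in_imageN.
  rewrite -[X in _ - X]scale1r -(sqrr_sign k (odd_perm g)) expr2 -scalerA -scalerBr.
  by apply: in_imageZ; rewrite -odd_permV; apply: sign_in_image.
exists (n%:R^-1 *: B); split.
- apply: lie_commZ; rewrite /B; elim/big_rec: _ => [|C X _ cX]; first exact: lie_comm0.
  exact: lie_commD.
- have -> : A - n%:R^-1 *: B = n%:R^-1 *: \sum_(C in rcosets H [set: 'S_5]) (A - f (repr C)).
    rewrite sumrB sumr_const -/n -scaler_nat scalerBr scalerA mulVf //.
    by rewrite scale1r.
  apply: in_imageZ; elim/big_rec: _ => [|C X _]; first exact: in_image0.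
  exact: in_imageD.
- move=> u; rewrite -scalemxAl scalerA mulrC -scalerA; congr (_ *: _).
  have muI : injective (fun C : {set 'S_5} => C :* u)%g.
    by move=> C D /(congr1 (fun C => C :* u^-1))%g; rewrite -!rcosetM mulgV !rcoset1.
  have mu C : ((C :* u)%g \in rcosets H [set: 'S_5]) = (C \in rcosets H [set: 'S_5]).
    apply/rcosetsP/rcosetsP => -[y _ E].
      by exists (y * u^-1)%g; rewrite ?inE // rcosetM -E -rcosetM mulgV rcoset1.
    by exists (y * u)%g; rewrite ?inE // rcosetM -E.
  rewrite /B [LHS]mulmx_suml scaler_sumr [LHS](reindex_inj muI) /=.
  rewrite (eq_bigl _ _ mu); apply: eq_bigr => C CH.
  have xC : (repr C * u)%g \in (C :* u)%g.
    have [y _ ->] := rcosetsP CH.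
    by rewrite mem_rcoset mulgK (mem_repr y) // rcoset_refl.
  rewrite -(frep _ _ _ xC) ?mu // /f odd_permM signr_addb invMg.
  rewrite -scalemxAl -mulmxA -perm_actM mulKVg scalerA.
  by congr (_ *: _); rewrite mulrC.
Qed.

(** Antisymmetrising under a transposition, correcting by [cycle_fix] and
    antisymmetrising again gives a map whose sign stabiliser contains the 3-cycle.
    As 9 does not divide 120, the index of this stabiliser is prime to 3. *)
Lemma exists_rskew A : lie_comm A ->
  exists B, [/\ lie_comm B, in_image (A - B) & rskew B].
Proof.
move=> cA; set t := tperm p0 p1.
pose A1 := 2%:R^-1 *: (A - A *m P t).
have tt : P t *m P t = 1%:M by rewrite -perm_actM tperm2 perm_act1.
have cP g B : lie_comm B -> lie_comm (B *m P g).
  by move=> cB; apply: lie_commM => //; apply: lie_comm_perm.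
have cN B : lie_comm B -> lie_comm (- B) by move=> cB; rewrite -scaleN1r; apply: lie_commZ.
have skew_half B : 2%:R^-1 *: (B - B *m P t) *m P t = - (2%:R^-1 *: (B - B *m P t)).
  by rewrite -scalemxAl mulmxBl -mulmxA tt mulmx1 -scalerN opprB.
have cA1 : lie_comm A1 by apply/lie_commZ/lie_commD => //; apply/cN/cP.
have A1t : A1 *m P t = - A1 by apply: skew_half.
have AA1 : in_image (A - A1).
  rewrite -[A in A - _](half_double char_k) -scalerBr opprB addrACA subrr addr0.
  rewrite -[A in A + _]mulmx1 -mulmxDr.
  by apply/in_imageZ/sym_in_image.
have [s' E] := cycle_fix char_k cA1 A1t.
set A2 := A1 - sact s' in E.
have cA2 : lie_comm A2 by apply: lie_commD => //; apply/cN/lie_comm_sact.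
pose A3 := 2%:R^-1 *: (A2 - A2 *m P t).
have cA3 : lie_comm A3 by apply/lie_commZ/lie_commD => //; apply/cN/cP.
have A3t : A3 *m P t = - A3 by apply: skew_half.
have A13 : in_image (A1 - A3).
  rewrite -[A1 in A1 - _](half_double char_k) -scalerBr /A2 mulmxBl A1t.
  have E0 (V : zmodType) (x y z : V) : x + x - (x - y - (- x - z)) = y - z.
    by rewrite opprB addrACA addNKr opprB [x + _]addrCA subrr addr0 addrC.
  rewrite E0.
  apply/in_imageZ/in_imageB; first by exists s'.
  by apply: in_imageM; [exists s'|exact: in_image_perm].
have A3c : A3 *m P c012 = A3.
  rewrite -scalemxAl mulmxBl E -mulmxA -[P t]sact_grp -[P c012]sact_grp -sactM tct.
  by rewrite !sactM !sact_grp !mulmxA !E.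
pose Hs := [set h | A3 *m P h == (-1) ^+ odd_perm h *: A3].
have gH : group_set Hs.
  apply/group_setP; split=> [|g h].
    by rewrite inE perm_act1 mulmx1 odd_perm1 scale1r.
  rewrite !inE => /eqP Eg /eqP Eh; apply/eqP.
  by rewrite perm_actM mulmxA Eh -scalemxAl Eg scalerA odd_permM signr_addb mulrC.
have [B [cB AB sB]] : exists B, [/\ lie_comm B, in_image (A3 - B) & rskew B].
  apply: (@average_rskew A3 (Group gH)) => //.
    by move=> h; rewrite inE => /eqP.
  have d3 : (3 %| #|Group gH|)%N.
    have c0H : c012 \in Group gH.
      by rewrite inE A3c odd_c012 scale1r.
    suff o3 : #[c012]%g = 3%N by have := order_dvdG c0H; rewrite o3.
    apply: nt_prime_order => //; first by rewrite !expgS expg0 mulg1 -c012V mulgV.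
    by apply/eqP => /permP/(_ p0); have [-> _ _ _ _] := c012E; rewrite perm1.
  apply/negP => d3'; have := dvdn_mul d3 d3'.
  by rewrite (Lagrange (subsetT _)) cardsT card_Sn.
exists B; split=> //.
have := in_imageD (in_imageD AA1 A13) AB.
by rewrite [A - A1 + _]addrA subrK addrA subrK.
Qed.

End Averaging.

(** * Skew equivariant maps are unique up to a scalar *)

Section Uniqueness.
Variables (k : fieldType) (char_k : 3%N \in [pchar k]).
Local Notation tix := (tix 2 1 5).
Local Notation tmx := (tmx 2 1 5 k).
Local Notation P := (@perm_act 2 1 5 k).
Local Notation sact := (@sact 2 1 5 k).
Local Notation sgx := (@sgn_exp 2 1 5).
Local Notation in_image := (@in_image 2 1 5 k).
Local Notation grp := (@grp k 5).
Local Notation alt := (@alt k 5).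
Implicit Types (A B : tmx) (I J : tix).

Let reg2 := char3_reg2 char_k.
Let two_neq0 := char3_two_neq0 char_k.

(** The elements s (1 + t) act as zero, hence are multiples of the alternating
    element; on the right by 1 + t they are doubled and also killed. *)
Lemma rskew_sact s : rskew (sact s) -> s = alt (s 1%g).
Proof.
move=> ss; apply: skewE => p q pq; set t := tperm p q.
have E : s * (1 + grp t) = alt ((s * (1 + grp t)) 1%g).
  apply: (sact_ker_alt reg2).
  rewrite sactM sactD sact1 sact_grp mulmxDr mulmx1 ss odd_tperm pq expr1.
  by rewrite scaleN1r subrr.
have tt : (1 + grp t) * (1 + grp t) = (1 + grp t) *+ 2.
  rewrite mulrDr mulr1 mulrDl mul1r grpM tperm2 grp1 [grp t + 1]addrC.
  by rewrite mulr2n.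
apply/ffunP => g; rewrite [RHS]ffunE; apply: reg2.
transitivity ((s * ((1 + grp t) *+ 2)) g); first by rewrite mulrnAr ffunMnE.
rewrite -tt mulrA E mulrDr mulr1 alt_grp odd_tperm pq /=.
by rewrite expr1 mulrN1 altN subrr ffunE.
Qed.

(** The transpose of B lies in the centralizer, so (1 + t) B comes from an element
    of the group algebra, which is a multiple of n because B is skew on the right.
    On the left by 1 + t, it is doubled and also killed. *)
Lemma rskew_tr B : lie_comm B -> rskew B -> rskew B^T.
Proof.
move=> cB sB.
have key (p q : 'I_5) : p != q -> P (tperm p q) *m B = - B.
  move=> pq; set t := tperm p q.
  have [s sE] : in_image ((1%:M + P t) *m B).
    rewrite -[_ *m B]trmxK; apply: in_image_tr; rewrite trmx_mul linearD /= trmx1.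
    by rewrite perm_act_tr tpermV; apply: sym_in_image => //; apply: lie_comm_tr.
  have s0 : s = alt (s 1%g).
    by apply: rskew_sact => u; rewrite sE -mulmxA sB -scalemxAr.
  have h2 : (1%:M + P t) *m ((1%:M + P t) *m B) = 2%:R *: ((1%:M + P t) *m B).
    rewrite mulmxA; have -> : (1%:M + P t) *m (1%:M + P t) = 2%:R *: (1%:M + P t).
      rewrite mulmxDl mul1mx mulmxDr mulmx1 -perm_actM tperm2 perm_act1.
      by rewrite scaler_nat mulr2n [P t + 1%:M]addrC.
    by rewrite scalemxAl.
  have h0 : (1%:M + P t) *m ((1%:M + P t) *m B) = 0.
    rewrite -sE s0 -sact1 -sact_grp -sactD -sactM mulrDl mul1r.
    by rewrite grp_alt odd_tperm pq /= expr1 mulrN1 altN subrr sact0.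
  have : (1%:M + P t) *m B = 0.
    by move/eqP: h0; rewrite h2 scaler_eq0 (negPf two_neq0) => /eqP.
  by rewrite mulmxDl mul1mx => /eqP; rewrite addrC addr_eq0 => /eqP.
move=> g; have [ts -> dts] := prod_tpermP g.
elim: ts dts => [_|[p q] ts IH] /=.
  by rewrite big_nil odd_perm1 expr0 scale1r perm_act1 mulmx1.
case/andP => pq /IH {}IH; rewrite big_cons odd_permM odd_tperm pq /= signrN scaleNr.
rewrite perm_actM mulmxA IH -scalemxAl -scalerN; congr (_ *: _).
by rewrite -[P _]trmxK perm_act_tr tpermV -trmx_mul key // linearN.
Qed.

(** Exchanging two equal even letters fixes the word with sign 1. *)
Lemma rskew_repeat B I J x : rskew B -> ~~ odd_ix x -> (1 < mult x J)%N ->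
  tentry B I J = 0.
Proof.
move=> sB xe /card_gt1P[p [q [Jp Jq pq]]].
have {Jp}Jp : J p = x by apply/eqP; move: Jp; rewrite inE.
have {Jq}Jq : J q = x by apply/eqP; move: Jq; rewrite inE.
have Jpq : J p = J q by rewrite Jp Jq.
have := congr1 (fun A => tentry A I J) (sB (tperm p q)).
rewrite tentry_mul_perm perm_tix_tperm // odd_tperm pq /= expr1 scaleN1r.
rewrite -signr_odd odd_sgn_exp_tperm // Jp (negPf xe) expr0 mulr1.
rewrite [in RHS]/tentry mxE -/(tentry _ _ _) => /esym.
exact: (char3_eqN (char3_nat0 char_k)).
Qed.

Lemma rskew_orbit B I J s : rskew B -> tentry B I J = 0 ->
  tentry B I (perm_tix s J) = 0.
Proof.
move=> sB B0; have := congr1 (fun A => tentry A I J) (sB s).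
rewrite tentry_mul_perm [in RHS]/tentry mxE -/(tentry _ _ _) B0 mulr0 => /eqP.
by rewrite mulf_eq0 signr_eq0 orbF => /eqP.
Qed.

(** When x does not occur in J, the derivation that replaces x by c has J as its
    only image of the word with x at the position q. *)
Lemma lie_comm_lower B J q x : lie_comm B -> J q = lc -> mult x J = 0%N ->
  (forall I, tentry B I (subst_letter J q x) = 0) -> forall I, tentry B I J = 0.
Proof.
move=> cB Jq x0 B0 I; set J' := subst_letter J q x.
have := congr1 (fun A => tentry A I J') (cB lc x).
rewrite [in RHS]tentry_mulE [RHS]big1 => [|L _]; last by rewrite B0 mulr0.
rewrite tentry_mul_lie_op (big_pred1 q) => [|p]; last first.
  rewrite !ffunE /=; case: (p =P q) => [_|pq]; first by rewrite eqxx.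
  apply/negP => Jp; move/eqP: x0; rewrite -leqn0 leqNgt => /negP[].
  by apply/card_gt0P; exists p; rewrite inE.
have -> : subst_letter J' q lc = J.
  by apply/ffunP => p; rewrite !ffunE; case: eqP => [->|].
by move/eqP; rewrite mulf_eq0 signr_eq0 => /eqP.
Qed.

Definition Jabccc : tix := [ffun q : 'I_5 => nth lc [:: la; lb] q].

Lemma mult_Jabccc : (mult la Jabccc = 1 /\ mult lb Jabccc = 1 /\ mult lc Jabccc = 3)%N.
Proof.
by do !split; rewrite /mult -sum1_card big_mkcond !big_ord_recl big_ord0 !inE !ffunE.
Qed.

Lemma orbit_Jabccc J : mult la J = 1%N -> mult lb J = 1%N -> exists s, J = perm_tix s Jabccc.
Proof.
move=> ha hb; apply: mult_perm_tix; have := sum_mult J; rewrite sum_letters.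
have [ra [rb rc]] := mult_Jabccc.
by move=> S; apply: letter_ind; lia.
Qed.

Lemma mult_subst J q x y : J q = lc -> y != lc ->
  mult y (subst_letter J q x) = ((y == x) + mult y J)%N.
Proof.
move=> Jq yc; rewrite /mult -!sum1_card !(big_mkcond (fun p => p \in _)) /=.
rewrite (bigD1 q) //= [in RHS](bigD1 q) //= !inE ffunE eqxx Jq.
rewrite [lc == y]eq_sym (negPf yc) add0n [y == x]eq_sym.
congr (_ + _)%N.
by apply: eq_bigr => p /negPf pq; rewrite !inE ffunE pq.
Qed.

(** A word that repeats an even letter contributes nothing.  On the orbit of
    abccc, symmetry reduces B to one entry; replacing a or b by c reaches the
    words abccc, bcccc, acccc, ccccc up to permutation, and these are all
    others. *)
Lemma skew_eq0 B : lie_comm B -> rskew B -> rskew B^T -> tentry B Jabccc Jabccc = 0 -> B = 0.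
Proof.
move=> cB sB sBt B00.
have ref0 I : tentry B I Jabccc = 0.
  apply/eqP/negP => /negP nz.
  have h i := char3_natr_eq char_k (lie_comm_mult cB i nz).
  have small x : ~~ odd_ix x -> (mult x I <= 1)%N.
    move=> xe; rewrite leqNgt; apply: contra nz => xI.
    by have := @rskew_repeat _ Jabccc _ _ sBt xe xI; rewrite /tentry mxE => ->.
  have [ra [rb rc]] := mult_Jabccc.
  have sa := small la isT; have sb := small lb isT.
  have := h la; have := h lb; rewrite ra rb => hb ha.
  have [s Is] : exists s, I = perm_tix s Jabccc by apply: orbit_Jabccc; lia.
  have BtT : tentry B^T Jabccc Jabccc = 0 by rewrite /tentry mxE.
  have := rskew_orbit s sBt BtT; rewrite /tentry mxE -Is => E.
  by rewrite /tentry E eqxx in nz.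
have good J : mult la J = 1%N -> mult lb J = 1%N -> forall I, tentry B I J = 0.
  by move=> h1 h2; have [s ->] := orbit_Jabccc h1 h2 => I; apply: rskew_orbit (ref0 I).
have hasc J : (mult la J <= 1)%N -> (mult lb J <= 1)%N -> exists q, J q = lc.
  move=> h1 h2; have := sum_mult J; rewrite sum_letters => S.
  have /card_gt0P[q] : (0 < mult lc J)%N by lia.
  by rewrite inE => /eqP; exists q.
(* The letters b and then a are removed by derivations that create a c. *)
have noa J : mult lb J = 1%N -> (mult la J <= 1)%N -> forall I, tentry B I J = 0.
  move=> h2 h1; have [ha|ha] : mult la J = 1%N \/ mult la J = 0%N by lia.
    exact: good.
  have [q Jq] := hasc J h1 (eq_leq h2).
  by apply: (lie_comm_lower cB Jq ha); apply: good; rewrite mult_subst // ?ha ?h2.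
apply: tmxP => I J; rewrite [RHS]mxE.
have [h1|] := leqP (mult la J) 1; last exact: rskew_repeat.
have [h2|] := leqP (mult lb J) 1; last exact: rskew_repeat.
have [hb|hb] : mult lb J = 1%N \/ mult lb J = 0%N by lia.
  exact: noa.
have [q Jq] := hasc J h1 h2.
by apply: (lie_comm_lower cB Jq hb); apply: noa; rewrite mult_subst // ?hb.
Qed.

End Uniqueness.

(** * A third of the alternating element *)

Section Third.
Local Notation tix := (tix 2 1 5).
Local Notation sgx := (@sgn_exp 2 1 5).
Local Notation P R := (@perm_act 2 1 5 R).

(** The matrix T of n/3; the division is exact by [alt_thirdZ_three]. *)
Definition alt_thirdZ : tmx 2 1 5 int :=
  tmx_of (fun I J : tix => (tentry (sact 2 1 (alt 5 (1 : int))) I J %/ 3)%Z).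

(** Five letters, of which two are even: either an even one is repeated or at
    most two positions are even. *)
Lemma tix_cases (I : tix) :
  (exists p q, [/\ p != q, I p = I q & ~~ odd_ix (I p)]) \/
  (exists p q r, [/\ p != q, q != r & r != p] /\ [/\ I p = lc, I q = lc & I r = lc]).
Proof.
have rep i : ~~ odd_ix i -> (1 < mult i I)%N ->
    exists p q, [/\ p != q, I p = I q & ~~ odd_ix (I p)].
  move=> ie /card_gt1P[p [q []]]; rewrite !inE => /eqP Ip /eqP Iq pq.
  by exists p, q; rewrite Ip Iq.
have [a2|a1] := ltnP 1 (mult la I); first by left; apply: rep a2.
have [b2|b1] := ltnP 1 (mult lb I); first by left; apply: rep b2.
have : (2 < mult lc I)%N by have := sum_mult I; rewrite sum_letters; lia.
case/card_gt2P => p [q [r [[Ip Iq Ir] ne]]]; right; exists p, q, r; split=> //.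
by split; apply/eqP; [move: Ip|move: Iq|move: Ir]; rewrite inE.
Qed.

Lemma three_cycle (I : tix) p q r : p != q -> q != r -> r != p ->
  I p = I q -> I q = I r ->
  exists c : 'S_5, [/\ c p != p, c (c (c p)) = p, odd_perm c = false,
    perm_tix c I = I & odd (sgx c I) = false].
Proof.
move=> pq qr rp Ipq Iqr; set t := tperm p q; set u := tperm q r.
have cp : (u * t)%g p = q.
  by rewrite permM /u /t [tperm q r p]tpermD ?tpermL // eq_sym.
have cq : (u * t)%g q = r by rewrite permM /u tpermL /t tpermD // eq_sym.
have cr : (u * t)%g r = p by rewrite permM /u tpermR /t tpermR.
have tI : perm_tix t I = I by apply: perm_tix_tperm.
have uI : perm_tix u I = I by apply: perm_tix_tperm.
exists (u * t)%g; rewrite cp cq cr odd_permM !odd_tperm pq qr perm_tixM uI tI.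
split=> //; first by rewrite eq_sym.
by rewrite odd_sgn_expM uI !odd_sgn_exp_tperm // Ipq addbb.
Qed.

Section Row.
Variable R : pzRingType.
Implicit Types (B : tmx 2 1 5 R) (I J L : tix).

(** The entry of sign(g) g. *)
Definition signed_entry (g : 'S_5) I J : R :=
  (-1) ^+ odd_perm g * tentry (P R g) I J.

Definition alt_entry I J : R := \sum_g signed_entry g I J.

Lemma signed_entryV g I J : signed_entry g^-1 J I = signed_entry g I J.
Proof.
rewrite /signed_entry odd_permV; congr (_ * _).
have -> : tentry (P R g^-1) J I = (if J == perm_tix g^-1 I then (-1) ^+ sgx g^-1 I else 0).
  by rewrite tmx_ofE.
rewrite tmx_ofE; have -> : (J == perm_tix g^-1 I) = (I == perm_tix g J).
  by apply/eqP/eqP => ->; rewrite ?perm_tixK ?perm_tixVK.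
by case: eqP => // ->; rewrite -signr_odd odd_sgn_expV signr_odd.
Qed.

Lemma alt_entryC I J : alt_entry I J = alt_entry J I.
Proof.
rewrite /alt_entry (reindex_inj invg_inj) /=.
by apply: eq_bigr => g _; rewrite -signed_entryV invgK.
Qed.

Lemma signed_entry_stab (c g : 'S_5) I L : odd_perm c = false -> perm_tix c I = I ->
  odd (sgx c I) = false -> signed_entry (c * g) L I = signed_entry g L I.
Proof.
move=> c0 cI sc; rewrite /signed_entry odd_permM c0; congr (_ * _).
rewrite !tmx_ofE perm_tixM cI; case: eqP => // _.
by rewrite -signr_odd odd_sgn_expM cI sc addbF signr_odd.
Qed.

(** A 3-cycle of equal odd letters fixes the word without sign, so the terms are
    constant on its cosets. *)
Lemma alt_entry_cycle (c : 'S_5) x I L : c x != x -> c (c (c x)) = x ->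
  odd_perm c = false -> perm_tix c I = I -> odd (sgx c I) = false ->
  alt_entry L I = (\sum_(g | min3 c x g) signed_entry g L I) *+ 3.
Proof.
move=> cx ccc c0 cI sc; apply: sum_cycle3 => // g.
exact: signed_entry_stab.
Qed.

Lemma signed_entry_rep (p q : 'I_5) g I L : p != q -> I p = I q -> ~~ odd_ix (I p) ->
  signed_entry (tperm p q * g) L I = - signed_entry g L I.
Proof.
move=> pq Ipq Ip; rewrite /signed_entry odd_permM odd_tperm pq /= signrN mulNr.
congr (- (_ * _)); rewrite !tmx_ofE perm_tixM perm_tix_tperm //.
case: eqP => // _; rewrite -signr_odd odd_sgn_expM perm_tix_tperm //.
by rewrite odd_sgn_exp_tperm // (negPf Ip) addbF signr_odd.
Qed.
End Row.

Lemma reg2_int (x : int) : x *+ 2 = 0 -> x = 0.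
Proof. by rewrite mulr2n; lia. Qed.

Lemma alt_entry_rep (p q : 'I_5) (I L : tix) : p != q -> I p = I q -> ~~ odd_ix (I p) ->
  alt_entry int L I = 0.
Proof.
move=> pq Ipq Ip; apply: reg2_int; rewrite mulr2n.
rewrite [X in X + _](reindex_inj (mulgI (tperm p q))) /= -big_split big1 // => g _.
by rewrite /= signed_entry_rep // addNr.
Qed.

Lemma sact_altE (K : comNzRingType) (I J : tix) :
  tentry (sact 2 1 (alt 5 (1 : K))) I J = alt_entry K I J.
Proof.
rewrite sactE [LHS]big_mkcond; apply: eq_bigr => g _.
by rewrite /signed_entry tmx_ofE ffunE mul1r; case: eqP; rewrite ?mulr0.
Qed.

(** Divisibility by 3, column by column: a column is zero when the word repeats an
    even letter, and is three times the sum over a transversal otherwise. *)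
Lemma alt_thirdZ_three : 3%:R *: alt_thirdZ = sact 2 1 (alt 5 (1 : int)).
Proof.
apply: tmxP => I J; rewrite {1}/tentry mxE -/(tentry _ I J) tmx_ofE.
rewrite sact_altE mulrC divzK //.
have [[p [q [pq Ipq Ip]]]|[p [q [r [[pq qr rp] [Ip Iq Ir]]]]]] := tix_cases J.
  by rewrite (alt_entry_rep I pq).
have [c [c1 c3 c0 cJ sc]] : exists c : 'S_5, [/\ c p != p, c (c (c p)) = p,
    odd_perm c = false, perm_tix c J = J & odd (sgx c J) = false].
  by apply: (three_cycle pq qr rp); rewrite ?Ip ?Iq ?Ir.
rewrite (alt_entry_cycle int I c1 c3 c0 cJ sc).
by rewrite -[X in (_ %| X)%Z]mulr_natr natz dvdz_mull.
Qed.

Lemma scale3_inj (A B : tmx 2 1 5 int) : 3%:R *: A = 3%:R *: B -> A = B.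
Proof.
by move=> /matrixP E; apply/matrixP => i j; have := E i j; rewrite !mxE => /mulfI; apply.
Qed.

Lemma alt_thirdZC (I J : tix) : tentry alt_thirdZ I J = tentry alt_thirdZ J I.
Proof. by rewrite !tmx_ofE !sact_altE alt_entryC. Qed.

Lemma alt_thirdZ_cycle (c : 'S_5) x (I L : tix) : c x != x -> c (c (c x)) = x ->
  odd_perm c = false -> perm_tix c I = I -> odd (sgx c I) = false ->
  tentry alt_thirdZ L I = \sum_(g | min3 c x g) signed_entry int g L I.
Proof.
move=> cx ccc c0 cI sc; rewrite tmx_ofE sact_altE.
by rewrite (alt_entry_cycle int L cx ccc c0 cI sc) -[X in (X %/ _)%Z]mulr_natr natz mulzK.
Qed.

Lemma alt_thirdZ_rep (p q : 'I_5) (I L : tix) : p != q -> I p = I q -> ~~ odd_ix (I p) ->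
  tentry alt_thirdZ L I = 0.
Proof.
by move=> pq Ipq Ip; rewrite tmx_ofE sact_altE (alt_entry_rep L pq Ipq Ip) div0z.
Qed.

Lemma perm_alt_thirdZ g : perm_act 2 1 int g *m alt_thirdZ = (-1) ^+ odd_perm g *: alt_thirdZ.
Proof.
apply: scale3_inj; rewrite scalemxAr alt_thirdZ_three -sact_grp -sactM grp_alt mul1r.
rewrite scalerA mulrC -scalerA alt_thirdZ_three -sactZ; congr sact.
by apply/ffunP => s; rewrite !ffunE mul1r.
Qed.

Lemma alt_thirdZ_perm g : alt_thirdZ *m perm_act 2 1 int g = (-1) ^+ odd_perm g *: alt_thirdZ.
Proof.
apply: scale3_inj; rewrite scalemxAl alt_thirdZ_three -sact_grp -sactM alt_grp mul1r.
rewrite scalerA mulrC -scalerA alt_thirdZ_three -sactZ; congr sact.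
by apply/ffunP => s; rewrite !ffunE mul1r.
Qed.

Lemma card_min3 (c : 'S_5) x : c x != x -> c (c (c x)) = x ->
  #|[pred g | min3 c x g]| = 40%N.
Proof.
move=> cx ccc; have := @sum_cycle3 nat 5 c x (fun=> 1%N) cx ccc (fun=> erefl).
have -> : #|[pred g | min3 c x g]| = (\sum_(g | min3 c x g) 1)%N.
  by rewrite sum1_card; apply: eq_card.
rewrite {1}sum1_card card_Sn; move: (\sum_(g | _) _)%N => N.
by rewrite -[N *+ 3]/(N + (N + N))%N -[5`!]/120%N; lia.
Qed.

Section Projection.
Variables (R : pzRingType) (three : 3%:R = 0 :> R).
Implicit Types (B : tmx 2 1 5 R) (I J L : tix).

(** The reduction of T to an arbitrary ring of coefficients. *)
Definition alt_third : tmx 2 1 5 R := map_mx intr alt_thirdZ.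

Lemma alt_thirdE I J : tentry alt_third I J = (tentry alt_thirdZ I J)%:~R.
Proof. by rewrite /tentry mxE. Qed.

Lemma signed_entry_intr g I J : (signed_entry int g I J)%:~R = signed_entry R g I J.
Proof.
rewrite /signed_entry !tmx_ofE; case: eqP => _; last by rewrite !mulr0.
by rewrite rmorphM !rmorph_sign.
Qed.

(** On a skew vector each of the 40 terms of a row of T gives the same value, and
    40 = 1.  A row without such terms belongs to a word with a repeated even
    letter, where a skew vector vanishes. *)
Lemma alt_third_mul_id B :
  (forall g, perm_act 2 1 R g *m B = (-1) ^+ odd_perm g *: B) -> alt_third *m B = B.
Proof.
move=> sB; apply: tmxP => I J; rewrite tentry_mulE.
have [[p [q [pq Ipq Ip]]]|[p [q [r [[pq qr rp] [Ip Iq Ir]]]]]] := tix_cases I.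
  rewrite big1 => [|L _]; last by rewrite alt_thirdE alt_thirdZC (alt_thirdZ_rep L pq Ipq Ip) mul0r.
  apply/esym/(char3_eqN three).
  have := congr1 (fun A => tentry A (perm_tix (tperm p q) I) J) (sB (tperm p q)).
  rewrite tentry_perm_mul perm_tix_tperm // odd_tperm pq expr1.
  rewrite -signr_odd odd_sgn_exp_tperm // (negPf Ip) expr0 mul1r => E.
  by rewrite [RHS]E /tentry mxE mulN1r.
have [c [c1 c3 c0 cI sc]] : exists c : 'S_5, [/\ c p != p, c (c (c p)) = p,
    odd_perm c = false, perm_tix c I = I & odd (sgx c I) = false].
  by apply: (three_cycle pq qr rp); rewrite ?Ip ?Iq ?Ir.
under eq_bigr => L _.
  rewrite alt_thirdE alt_thirdZC (alt_thirdZ_cycle L c1 c3 c0 cI sc) rmorph_sum mulr_suml /=.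
  over.
rewrite exchange_big /= -[RHS]mul1r -[in RHS](char3_forty three) -(card_min3 c1 c3) -sum1_card.
rewrite natr_sum mulr_suml; apply: eq_bigr => g _.
rewrite mul1r; transitivity (tentry ((-1) ^+ odd_perm g *: (perm_act 2 1 R g^-1 *m B)) I J).
  rewrite /tentry mxE -/(tentry _ I J) tentry_mulE mulr_sumr.
  apply: eq_bigr => L _; rewrite signed_entry_intr -signed_entryV mulrA.
  by rewrite /signed_entry odd_permV.
by rewrite sB odd_permV scalerA -expr2 sqrr_sign scale1r.
Qed.

Lemma mul_alt_third_id B :
  (forall g, B *m perm_act 2 1 R g = (-1) ^+ odd_perm g *: B) -> B *m alt_third = B.
Proof.
move=> sB; apply: tmxP => I J; rewrite tentry_mulE.
have [[p [q [pq Jpq Jp]]]|[p [q [r [[pq qr rp] [Jp Jq Jr]]]]]] := tix_cases J.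
  rewrite big1 => [|L _]; last by rewrite alt_thirdE (alt_thirdZ_rep L pq Jpq Jp) mulr0.
  apply/esym/(char3_eqN three).
  have := congr1 (fun A => tentry A I J) (sB (tperm p q)).
  rewrite tentry_mul_perm perm_tix_tperm // odd_tperm pq expr1.
  rewrite -signr_odd odd_sgn_exp_tperm // (negPf Jp) expr0 mulr1 => E.
  by rewrite [RHS]E /tentry mxE mulN1r.
have [c [c1 c3 c0 cJ sc]] : exists c : 'S_5, [/\ c p != p, c (c (c p)) = p,
    odd_perm c = false, perm_tix c J = J & odd (sgx c J) = false].
  by apply: (three_cycle pq qr rp); rewrite ?Jp ?Jq ?Jr.
under eq_bigr => L _.
  rewrite alt_thirdE (alt_thirdZ_cycle L c1 c3 c0 cJ sc) rmorph_sum mulr_sumr /=.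
  over.
rewrite exchange_big /= -[RHS]mul1r -[in RHS](char3_forty three) -(card_min3 c1 c3) -sum1_card.
rewrite natr_sum mulr_suml; apply: eq_bigr => g _.
rewrite mul1r; transitivity (tentry ((-1) ^+ odd_perm g *: (B *m perm_act 2 1 R g)) I J).
  rewrite /tentry mxE -/(tentry _ I J) tentry_mulE mulr_sumr.
  apply: eq_bigr => L _; rewrite signed_entry_intr /signed_entry !mulrA.
  by rewrite commr_sign.
by rewrite sB scalerA -expr2 sqrr_sign scale1r.
Qed.

Lemma map_perm_act_intr (g : 'S_5) : map_mx intr (perm_act 2 1 int g) = perm_act 2 1 R g.
Proof. exact: map_perm_act. Qed.

Lemma perm_alt_third (g : 'S_5) : perm_act 2 1 R g *m alt_third = (-1) ^+ odd_perm g *: alt_third.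
Proof.
by rewrite /alt_third -map_perm_act_intr -map_mxM perm_alt_thirdZ map_mxZ rmorph_sign.
Qed.

Lemma alt_third_perm (g : 'S_5) : alt_third *m perm_act 2 1 R g = (-1) ^+ odd_perm g *: alt_third.
Proof.
by rewrite /alt_third -map_perm_act_intr -map_mxM alt_thirdZ_perm map_mxZ rmorph_sign.
Qed.

(** B T has skew columns and T B has skew rows, so T B T equals both. *)
Lemma alt_third_comm B : (forall g : 'S_5, B *m perm_act 2 1 R g = perm_act 2 1 R g *m B) ->
  B *m alt_third = alt_third *m B.
Proof.
move=> cB.
have sc (b : bool) (C D : tmx 2 1 5 R) : C *m ((-1) ^+ b *: D) = (-1) ^+ b *: (C *m D).
  by case: b; rewrite ?expr0 ?expr1 ?scale1r // !scaleN1r mulmxN.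
rewrite -[LHS]alt_third_mul_id => [|g]; last by rewrite mulmxA -cB -mulmxA perm_alt_third sc.
rewrite mulmxA mul_alt_third_id // => g.
by rewrite -mulmxA cB mulmxA alt_third_perm -scalemxAl.
Qed.

End Projection.

End Third.

(** * The centralizer algebra in characteristic 3 *)

Section OverField.
Local Notation tix := (tix 2 1 5).
Local Notation sgx := (@sgn_exp 2 1 5).
Local Notation P R := (@perm_act 2 1 5 R).

Definition Jccccc : tix := [ffun=> lc].

Lemma odd_sgn_exp_Jccccc (g : 'S_5) : odd (sgx g Jccccc) = odd_perm g.
Proof.
have [ts -> dts] := prod_tpermP g.
elim: ts dts => [_|[p q] ts IH] /=; first by rewrite big_nil odd_perm1 odd_sgn_exp1.
case/andP => pq /IH {}IH; rewrite big_cons odd_sgn_expM odd_permM odd_tperm pq.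
by rewrite perm_tix_tperm ?odd_sgn_exp_tperm ?ffunE // IH addbC.
Qed.

(** On ccccc the group acts by the sign, so n acts as 120. *)
Lemma alt_thirdZ_Jccccc : tentry alt_thirdZ Jccccc Jccccc = 40.
Proof.
rewrite tmx_ofE sact_altE /alt_entry.
rewrite (eq_bigr (fun=> 1)) => [|g _].
  by rewrite sumr_const card_Sn.
rewrite /signed_entry tmx_ofE (_ : perm_tix g Jccccc = Jccccc).
  by rewrite eqxx -[X in _ * X]signr_odd odd_sgn_exp_Jccccc -expr2 sqrr_sign.
by apply/ffunP => q; rewrite !ffunE.
Qed.

Lemma sact_alt1 (K : comNzRingType) : sact 2 1 (alt 5 (1 : K)) = 3%:R *: alt_third K.
Proof.
rewrite /alt_third -[3%:R]/(3%:R : K) -(rmorph_nat (intr : int -> K) 3) -map_mxZ alt_thirdZ_three.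
apply: tmxP => I J; rewrite /tentry mxE -!/(tentry _ I J) !sact_altE.
by rewrite rmorph_sum /=; apply: eq_bigr => g _; rewrite signed_entry_intr.
Qed.

Lemma sact_alt (K : comNzRingType) (c : K) : sact 2 1 (alt 5 c) = (c * 3%:R) *: alt_third K.
Proof.
rewrite -scalerA -sact_alt1 -sactZ; congr sact.
by apply/ffunP => g; rewrite !ffunE mul1r.
Qed.

Section CharThree.
Variables (k : fieldType) (char_k : 3%N \in [pchar k]).
Implicit Types (A B : tmx 2 1 5 k) (a : grpalg k 5).
Let reg2 := char3_reg2 char_k.

(** GL commutes with the symmetric group over every supercommutative superalgebra. *)
Lemma End_GL_alt_third : End_GL (alt_third k).
Proof.
split=> [I J ne|R g [gh _]].
  rewrite alt_thirdE tmx_ofE sact_altE /alt_entry big1 ?div0z // => s _.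
  rewrite /signed_entry tmx_ofE; case: (I =P perm_tix s J) ne => [->|_ _]; last by rewrite mulr0.
  by rewrite odd_perm_tix eqxx.
have -> : map_mx (in_alg R) (alt_third k) = alt_third R.
  by apply/matrixP => i j; rewrite !mxE rmorph_int.
apply: alt_third_comm => [|s]; last exact: gl_act_equivariant.
by rewrite -(rmorph_nat (in_alg R)) (char3_nat0 char_k) rmorph0.
Qed.

Lemma End_GLD A B : End_GL A -> End_GL B -> End_GL (A + B).
Proof.
case=> pA hA [pB hB]; split=> [I J ne|R g gh].
  by rewrite /tentry mxE -!/(tentry _ _ _) pA // pB // addr0.
by rewrite map_mxD mulmxDl mulmxDr hA // hB.
Qed.

Lemma End_GLZ c A : End_GL A -> End_GL (c *: A).
Proof.
case=> pA hA; split=> [I J ne|R g gh].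
  by rewrite /tentry mxE -!/(tentry _ _ _) pA // mulr0.
have -> : map_mx (in_alg R) (c *: A) = c%:A *: map_mx (in_alg R) A.
  by rewrite map_mxZ.
have cC (x : R) : c%:A * x = x * c%:A by rewrite -scalerAl mul1r -scalerAr mulr1.
apply/matrixP => i j; have /matrixP/(_ i j) := hA R g gh; rewrite !mxE => E.
have sE l l' : (c%:A *: map_mx (in_alg R) A) l l' = c%:A * map_mx (in_alg R) A l l'.
  by rewrite mxE.
transitivity (c%:A * (\sum_l gl_act 5 g i l * map_mx (in_alg R) A l j)).
  by rewrite mulr_sumr; apply: eq_bigr => l _; rewrite sE !mulrA cC.
by rewrite E mulr_sumr; apply: eq_bigr => l _; rewrite sE mulrA.
Qed.

Lemma End_GL_sact a : End_GL (sact 2 1 a).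
Proof.
rewrite /sact; elim/big_ind: _ => [|A B|s _]; last exact/End_GLZ/End_GL_perm_act.
  by rewrite -(scale0r (P k 1%g)); apply/End_GLZ/End_GL_perm_act.
exact: End_GLD.
Qed.

Lemma lie_comm_alt_third : lie_comm (alt_third k).
Proof. exact/End_GL_lie_comm/End_GL_alt_third. Qed.

Lemma rskew_alt_third : rskew (alt_third k).
Proof. by move=> g; rewrite alt_third_perm. Qed.

Lemma alt_third_Jccccc : tentry (alt_third k) Jccccc Jccccc = 1.
Proof. by rewrite alt_thirdE alt_thirdZ_Jccccc -(pmulrn 1 40) (char3_forty (char3_nat0 char_k)). Qed.

Lemma alt_third_neq0 : alt_third k != 0.
Proof.
apply/eqP => T0; have := alt_third_Jccccc; rewrite T0 /tentry mxE => /esym/eqP.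
by rewrite oner_eq0.
Qed.

(** The skew map left by [exists_rskew] is a multiple of T by [skew_eq0], whose
    single entry is nonzero for T since T itself is not zero. *)
Lemma End_GL_decomp A : End_GL A -> exists a y, A = sact 2 1 a + y *: alt_third k.
Proof.
move/End_GL_lie_comm => cA; have [B [cB [a aE] sB]] := exists_rskew char_k cA.
have cT := lie_comm_alt_third; have sT := rskew_alt_third.
set t0 := tentry (alt_third k) Jabccc Jabccc.
have t0n : t0 != 0.
  apply: contra alt_third_neq0 => /eqP t0E; apply/eqP/(skew_eq0 char_k) => //.
  exact: rskew_tr.
exists a, (tentry B Jabccc Jabccc / t0).
rewrite aE -[A in LHS](subrK B); congr (_ + _); apply/eqP; rewrite -subr_eq0; apply/eqP.
have rskewB (C D : tmx 2 1 5 k) c : rskew C -> rskew D -> rskew (C - c *: D).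
  move=> sC sD g; rewrite mulmxBl -scalemxAl sC sD scalerBr !scalerA.
  by rewrite [c * _]mulrC.
apply: (skew_eq0 char_k).
- by rewrite -scaleNr; apply: lie_commD => //; apply: lie_commZ.
- exact: rskewB.
- rewrite linearB linearZ; apply: rskewB; exact: rskew_tr.
- by rewrite {1}/tentry mxE mxE mxE -!/(tentry _ _ _) -/t0 divfK // subrr.
Qed.

(** If T came from the group algebra, it would come from a multiple of n because
    it is skew; but n acts as 3T = 0. *)
Lemma sact_alt_third_eq0 a y : sact 2 1 a + y *: alt_third k = 0 -> y = 0 /\ a = alt 5 (a 1%g).
Proof.
move=> E; suff y0 : y = 0.
  by split=> //; apply: (sact_ker_alt reg2); move: E; rewrite y0 scale0r addr0.
apply/eqP/negP => /negP yn; case/eqP: alt_third_neq0.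
have {E}Ea : sact 2 1 a = - y *: alt_third k by apply/eqP; rewrite scaleNr -addr_eq0 E.
have sa : rskew (sact 2 1 a).
  by move=> g; rewrite Ea -scalemxAl rskew_alt_third !scalerA mulrC.
have aE := rskew_sact char_k sa.
have : - y *: alt_third k = 0 by rewrite -Ea aE sact_alt (char3_nat0 char_k) mulr0 scale0r.
by move/eqP; rewrite scaler_eq0 oppr_eq0 (negPf yn) => /eqP.
Qed.

End CharThree.

End OverField.

(** * Elements of Z[1/3]S_5 with integral action *)

Section Integral.
Local Notation tix := (tix 2 1 5).
Local Notation sgx := (@sgn_exp 2 1 5).
Local Notation P R := (@perm_act 2 1 5 R).
Local Notation ZG := (grpalg Zthird 5).

Lemma Zthird_val_intr (z : int) : Zthird_val z%:~R = z%:~R.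
Proof. exact: (rmorph_int (val : Zthird -> rat)). Qed.

Lemma Zthird_intr_inj : injective (intr : int -> Zthird).
Proof.
by move=> x y /(congr1 Zthird_val); rewrite !Zthird_val_intr => /intr_inj.
Qed.

Lemma Zthird_mulrn_eq0 (x : Zthird) d : (0 < d)%N -> x *+ d = 0 -> x = 0.
Proof.
move=> d0 /(congr1 (val : Zthird -> rat)); rewrite rmorphMn rmorph0 => /eqP.
rewrite -mulr_natr mulf_eq0 Num.Theory.pnatr_eq0 (gtn_eqF d0) orbF => /eqP v0.
by apply: val_inj; rewrite v0 rmorph0.
Qed.

Definition integral (x : Zthird) := exists z : int, x = z%:~R.

Lemma integralD x y : integral x -> integral y -> integral (x + y).
Proof. by case=> z -> [w ->]; exists (z + w); rewrite rmorphD. Qed.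
Lemma integralM x y : integral x -> integral y -> integral (x * y).
Proof. by case=> z -> [w ->]; exists (z * w); rewrite rmorphM. Qed.
Lemma integralX e : integral ((-1) ^+ e).
Proof. by exists ((-1) ^+ e); rewrite rmorph_sign. Qed.

(** Bezout for d and the power of 3 that clears the denominator of x. *)
Lemma integral_coprime x d : coprime d 3 -> integral (x *+ d) -> integral x.
Proof.
case: x => x xP d3 [z /(congr1 Zthird_val)].
rewrite -[Zthird_val (_ *+ _)]/(val _) rmorphMn /= Zthird_val_intr => E.
case/asboolP: (xP) => e /Num.Theory.intrP[w Ew].
have [u [v uv]] := Bezoutz d (3 ^ e)%N.
have {}uv : u * d + v * (3 ^ e)%N = 1.
  by rewrite uv /gcdz /= (eqP (coprimeXr e d3)).
have U : u%:~R * d%:R + v%:~R * 3%:R ^+ e = 1 :> rat.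
  by have := congr1 (intr : int -> rat) uv; rewrite rmorphD !rmorphM /= -!pmulrn natrX.
exists (u * z + v * w); apply: val_inj; rewrite /= Zthird_val_intr.
rewrite rmorphD !rmorphM /= -E -Ew; apply: (etrans (esym (mul1r x))); rewrite -{1}U.
by rewrite -mulr_natr; ring.
Qed.

Definition gen_third : ZG := [ffun s : 'S_5 => third * (-1) ^+ s].

Lemma third3 : third *+ 3 = 1.
Proof. by apply: val_inj; rewrite rmorphMn rmorph1 /= -mulr_natr mulVf. Qed.

Lemma gen_thirdE : gen_third = alt 5 third.
Proof. by []. Qed.

Lemma sact_gen_third : sact 2 1 gen_third = alt_third Zthird.
Proof. by rewrite gen_thirdE sact_alt mulr_natr third3 scale1r. Qed.

Lemma base_change_perm (K : comNzRingType) g : base_change K (P int g) = P K g.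
Proof. exact: map_perm_act_intr. Qed.

Lemma base_change_sact (K : comNzRingType) (b : grpalg int 5) :
  base_change K (sact 2 1 b) = sact 2 1 ([ffun g => (b g)%:~R] : grpalg K 5).
Proof.
rewrite /sact rmorph_sum; apply: eq_bigr => g _.
by rewrite ffunE -[LHS]/(map_mx intr (b g *: P int g)) map_mxZ map_perm_act_intr.
Qed.

Lemma base_change_Zthird_inj : injective (@base_change 2 1 5 Zthird).
Proof.
move=> A B /matrixP E; apply/matrixP => i j; have := E i j; rewrite !mxE.
exact: Zthird_intr_inj.
Qed.

Definition integral_action (a : ZG) := exists A, sact 2 1 a = base_change Zthird A.

Lemma integral_action_sym (a : ZG) (p q : 'I_5) g : p != q ->
  integral_action a -> integral ((a * (1 + grp Zthird (tperm p q))) g).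
Proof.
move=> pq [A aA]; have [u ->] := tperm_conj01 pq.
rewrite mul_sym_conj grpalg_mulgrpE; apply: (@integral_coprime _ 2) => //.
rewrite two_mul_sym sactM aA sact_grp -base_change_perm -[_ *m _]/(_ * _) -rmorphM.
have ent (B : tmx 2 1 5 int) I J : integral (tentry (base_change Zthird B) I J).
  by exists (tentry B I J); rewrite /tentry mxE.
by apply: integralD; apply: integralM; (exact: integralX || exact: ent).
Qed.

(** Along a product of transpositions, each step changes the sign of the
    coefficient modulo integers by [integral_action_sym]. *)
Lemma integral_sub_alt (a : ZG) g : integral_action a ->
  integral (a g - (-1) ^+ odd_perm g * a 1%g).
Proof.
move=> ia; have [ts -> dts] := prod_tpermP g.
elim: ts dts => [_|[p q] ts IH] /=.
  by rewrite big_nil odd_perm1 mul1r subrr; exists 0.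
case/andP => pq /IH {}IH; rewrite big_cons odd_permM odd_tperm pq signrN mulNr opprK.
set g' := (\prod_(_ <- _) _)%g in IH *.
have := integral_action_sym g' pq ia.
rewrite mulrDr mulr1 ffunE grpalg_mulgrpE tpermV => h.
have E (R : comNzRingType) (x y w : R) : x + w = (y + x) + (-1) ^+ 1 * (y - w) by ring.
rewrite (E _ _ (a g')).
apply: integralD => //; apply: integralM => //; exact: integralX.
Qed.

(** After subtracting the integral part, a is c n for c the coefficient of the
    identity, and acts as 3c T.  The entry 40 of T makes 120 c an integer, hence
    also 3c. *)
Lemma integral_action_decomp (a : ZG) A : sact 2 1 a = base_change Zthird A ->
  exists (b : grpalg int 5) z, a = [ffun g => (b g)%:~R] + gen_third *~ z /\
    A = sact 2 1 b + alt_thirdZ *~ z.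
Proof.
move=> aA; have ia : integral_action a by exists A.
have [f fE] := fin_all_exists (fun g => integral_sub_alt g ia).
pose b : grpalg int 5 := [ffun g => f g].
pose mb : ZG := [ffun g => (b g)%:~R].
have abE : a = mb + alt 5 (a 1%g).
  by apply/ffunP => g; rewrite [RHS]ffunE !ffunE -fE [_ * a _]mulrC subrK.
have [z zE] : integral (a 1%g *+ 3).
  apply: (@integral_coprime _ 40) => //.
  exists (tentry A Jccccc Jccccc - tentry (sact 2 1 b) Jccccc Jccccc).
  have := congr1 (fun B => tentry B Jccccc Jccccc) aA.
  have tE (B C : tmx 2 1 5 Zthird) c : tentry (B + c *: C) Jccccc Jccccc =
      tentry B Jccccc Jccccc + c * tentry C Jccccc Jccccc by rewrite /tentry mxE mxE.
  have bE (B : tmx 2 1 5 int) :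
      tentry (base_change Zthird B) Jccccc Jccccc = (tentry B Jccccc Jccccc)%:~R.
    by rewrite /tentry mxE.
  rewrite /= {1}abE sactD -base_change_sact sact_alt tE !bE rmorphB /= => <-.
  by rewrite alt_thirdZ_Jccccc addrC addKr -(pmulrn 1 40) !mulr_natr.
have alt3 : alt 5 (a 1%g) = gen_third *~ z.
  rewrite gen_thirdE -raddfMz; congr alt; rewrite -mulrzr -zE mulrnAr -mulrnAl.
  by rewrite third3 mul1r.
exists b, z; rewrite -alt3 -abE; split=> //.
apply: base_change_Zthird_inj.
rewrite -aA {1}abE sactD -base_change_sact rmorphD /=; congr (_ + _).
rewrite sact_alt rmorphMz mulr_natr zE scaler_int; congr (_ *~ _).
Qed.

End Integral.

(** * Formal tensors *)

Section Pure.
Variables (k : comNzRingType) (M : zmodType).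

Lemma pureDr a (x y : M) : pure (a : k) (x + y) = pure a x + pure a y.
Proof. by apply: tensZP => W b bb; rewrite tens_liftD // !lift_pure // bb.2. Qed.

Lemma pureDl a c (x : M) : pure (a + c : k) x = pure a x + pure c x.
Proof. by apply: tensZP => W b bb; rewrite tens_liftD // !lift_pure // bb.1. Qed.

Lemma pure_is_zmod_morphism (a : k) : zmod_morphism (@pure k M a).
Proof.
move=> x y; apply/eqP; rewrite -(inj_eq (addIr (pure a y))) -pureDr !subrK.
by [].
Qed.

HB.instance Definition _ (a : k) :=
  GRing.isZmodMorphism.Build M (tensZ k M) (@pure k M a) (pure_is_zmod_morphism a).

(** [pure] as a function of its scalar, so as to be an additive map. *)
Definition purel (x : M) (a : k) := pure a x.

Lemma purel_is_zmod_morphism (x : M) : zmod_morphism (purel x).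
Proof.
move=> a c; apply/eqP; rewrite -(inj_eq (addIr (purel x c))) -[_ + _]pureDl !subrK.
by [].
Qed.

HB.instance Definition _ (x : M) :=
  GRing.isZmodMorphism.Build k (tensZ k M) (purel x) (purel_is_zmod_morphism x).

Lemma pureMz a (x : M) z : pure (a : k) (x *~ z) = pure (a * z%:~R) x.
Proof. by rewrite raddfMz mulrzr -![pure _ x]/(purel x _) raddfMz. Qed.

Lemma pure0l (x : M) : pure (0 : k) x = 0.
Proof. exact: (raddf0 (purel x)). Qed.

Lemma tens_ofE (s : seq (k * M)) : tens_of s = \sum_(u <- s) pure u.1 u.2.
Proof.
elim: s => [|u s IH]; first by rewrite big_nil.
rewrite big_cons -IH; apply: tensZP => W b bb.
by rewrite tens_liftD // !tens_liftE // /fsum big_cons big_seq1.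
Qed.

End Pure.

(** * Scalar extension of the saturated ring *)

Section ScalarExtension.
Local Notation tix := (tix 2 1 5).
Local Notation P R := (@perm_act 2 1 5 R).
Local Notation ZG := (grpalg Zthird 5).

Lemma perm_in_Sigma g : P int g \in Sigma_pred (m := 2) (n := 1) (r := 5).
Proof. by apply/asboolP; exists (grp Zthird g); rewrite sact_grp base_change_perm. Qed.

Lemma alt_thirdZ_in_Sigma : alt_thirdZ \in Sigma_pred (m := 2) (n := 1) (r := 5).
Proof. by apply/asboolP; exists gen_third; rewrite sact_gen_third. Qed.

Definition SigmaZ_perm g : SigmaZ 2 1 5 := MkSigmaZ (perm_in_Sigma g).
Definition SigmaZ_third : SigmaZ 2 1 5 := MkSigmaZ alt_thirdZ_in_Sigma.

Lemma SigmaZ_decomp (A : SigmaZ 2 1 5) : exists (b : 'S_5 -> int) z,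
  A = \sum_g SigmaZ_perm g *~ b g + SigmaZ_third *~ z.
Proof.
case: A => A AS; have /asboolP[a /integral_action_decomp[b [z [_ AE]]]] := AS.
exists b, z; apply: val_inj; rewrite [RHS]raddfD raddfMz raddf_sum /= AE.
congr (_ + _); rewrite /sact; apply: eq_bigr => g _.
by rewrite -[RHS]/(val _) raddfMz /= -scaler_int intz.
Qed.

(** The relation between the generators that makes n vanish after tensoring with
    k. *)
Lemma SigmaZ_third3 : SigmaZ_third *+ 3 = \sum_g SigmaZ_perm g *~ (-1) ^+ odd_perm g.
Proof.
apply: val_inj; rewrite raddfMn raddf_sum /= -scaler_nat alt_thirdZ_three /sact.
apply: eq_bigr => g _.
by rewrite -[RHS]/(val _) raddfMz /= -scaler_int intz ffunE mul1r.
Qed.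

Section Final.
Variables (k : fieldType) (char_k : 3%N \in [pchar k]).
Local Notation Sigma := (Sigma 2 1 5 k).

(** The normal form of an element of the scalar extension. *)
Definition Sigma_comb (c : grpalg k 5) (y : k) : Sigma :=
  \sum_g pure (c g) (SigmaZ_perm g) + pure y SigmaZ_third.

Lemma Sigma_combD c c' y y' :
  Sigma_comb (c + c') (y + y') = Sigma_comb c y + Sigma_comb c' y'.
Proof.
rewrite /Sigma_comb addrACA -big_split /= pureDl; congr (_ + _).
by apply: eq_bigr => g _; rewrite ffunE pureDl.
Qed.

Lemma Sigma_normal (x : Sigma) : exists c y, x = Sigma_comb c y.
Proof.
rewrite -(tens_reprK x) tens_ofE.
elim: (tens_repr x) => [|[a A] s [c [y E]]].
  exists 0, 0; rewrite big_nil /Sigma_comb pure0l addr0 big1 // => g _.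
  by rewrite ffunE pure0l.
have [b [z AE]] := SigmaZ_decomp A.
exists ([ffun g => a * (b g)%:~R] + c), (a * z%:~R + y).
rewrite big_cons E Sigma_combD; congr (_ + _).
rewrite /= AE raddfD raddf_sum /= /Sigma_comb pureMz; congr (_ + _).
by apply: eq_bigr => g _; rewrite pureMz ffunE.
Qed.

Lemma Phit_comb c y : Phit (Sigma_comb c y) = sact 2 1 c + y *: alt_third k.
Proof.
rewrite /Sigma_comb raddfD raddf_sum /= Phit_pure; congr (_ + _).
rewrite /sact; apply: eq_bigr => g _; rewrite Phit_pure /=.
by rewrite base_change_perm.
Qed.

(** An element of the kernel in normal form has no T part and its group algebra
    part is lam n; in the tensor product lam (x) n = 3 lam (x) T = 0. *)
Lemma Phit_inj : injective (@Phit 2 1 5 k).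
Proof.
apply: raddf_inj => x; have [c [y ->]] := Sigma_normal x.
rewrite /= Phit_comb => /(sact_alt_third_eq0 char_k)[-> cE].
rewrite /Sigma_comb pure0l addr0 cE; move: (c 1%g) => lam.
transitivity (pure lam (\sum_g SigmaZ_perm g *~ (-1) ^+ odd_perm g) : Sigma).
  rewrite raddf_sum; apply: eq_bigr => g _.
  by rewrite /= pureMz ffunE rmorph_sign.
by rewrite -SigmaZ_third3 pmulrn pureMz -pmulrn (char3_nat0 char_k) mulr0 pure0l.
Qed.

Lemma End_GL_Phit (A : tmx 2 1 5 k) : End_GL A <-> exists x : Sigma, Phit x = A.
Proof.
split=> [/(End_GL_decomp char_k)[c [y ->]]|[x <-]].
  by exists (Sigma_comb c y); rewrite Phit_comb.
have [c [y ->]] := Sigma_normal x; rewrite Phit_comb.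
by apply: End_GLD; [apply: End_GL_sact|apply/End_GLZ/End_GL_alt_third].
Qed.

Definition sact_ffun (a : {ffun 'S_5 -> k^o}) : tmx 2 1 5 k := sact 2 1 (a : grpalg k 5).

Lemma sact_ffun_is_linear : linear sact_ffun.
Proof.
move=> c a b; rewrite /sact_ffun sactD -sactZ.
by congr (_ + _); congr sact; apply/ffunP => g; rewrite !ffunE.
Qed.

HB.instance Definition _ := GRing.isLinear.Build k {ffun 'S_5 -> k^o} (tmx 2 1 5 k) _
  sact_ffun sact_ffun_is_linear.

Definition sact_hom := linfun sact_ffun.

Lemma mem_limg_sact A : A \in limg sact_hom <-> exists a : grpalg k 5, sact 2 1 a = A.
Proof.
split=> [/memv_imgP[a _ ->]|[a <-]]; first by exists a; rewrite lfunE.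
by rewrite -[sact _ _ _]/(sact_ffun a) -(lfunE sact_ffun) memv_img // memvf.
Qed.

(** The kernel is the line spanned by the alternating element. *)
Lemma dim_limg_sact : \dim (limg sact_hom) = 119%N.
Proof.
have := limg_ker_dim sact_hom fullv; rewrite capfv dimvf.
have -> : lker sact_hom = <[alt 5 (1 : k) : {ffun 'S_5 -> k^o}]>%VS.
  apply/vspaceP => a; apply/idP/vlineP => [|[c ->]].
    rewrite memv_ker lfunE => /eqP a0; exists ((a : grpalg k 5) 1%g).
    rewrite {1}(sact_ker_alt (char3_reg2 char_k) a0).
    by apply/ffunP => g; rewrite !ffunE mul1r.
  rewrite memv_ker linearZ /= /sact_hom lfunE /= /sact_ffun sact_alt.
  by rewrite (char3_nat0 char_k) mulr0 scale0r scaler0.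
rewrite dim_vline.
have -> : (alt 5 (1 : k) : {ffun 'S_5 -> k^o}) != 0.
  by apply/eqP => /ffunP/(_ 1%g)/eqP; rewrite !ffunE odd_perm1 mulr1 oner_eq0.
have -> : dim {ffun 'S_5 -> k^o} = 120%N by rewrite /dim /= card_Sn.
by rewrite add1n => -[].
Qed.

End Final.

End ScalarExtension.

(** * The theorem *)

Theorem theorem5 (k : fieldType) (char_k : 3%N \in [pchar k]) :
  (* (i) *)
  (has_dim (@End_GL k 2 1 5) 120 /\
   has_dim (fun A : tmx 2 1 5 k => exists a : grpalg k 5, sact 2 1 a = A) 119)
  /\
  (* (ii) *)
  [/\ linear (@Phit 2 1 5 k), monoid_morphism (@Phit 2 1 5 k),
      injective (@Phit 2 1 5 k)
    & forall A : tmx 2 1 5 k,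
        End_GL A <-> exists x : Sigma 2 1 5 k, Phit x = A]
  /\
  (* (iii) *)
  (injective (@sact 2 1 5 Zthird) /\
   forall a : grpalg Zthird 5,
     (exists A : SigmaZ 2 1 5, sact 2 1 a = base_change Zthird (SigmaZ_val A))
     <-> subring_gen (fun b : grpalg Zthird 5 =>
           (exists s : 'S_5, b = grp Zthird s) \/
           b = [ffun s : 'S_5 => third * (-1) ^+ s]) a).
Proof.
split; last split.
- split; last by exists (limg (sact_hom k)); split;
    [exact: mem_limg_sact | exact: dim_limg_sact].
  exists (limg (sact_hom k) + <[alt_third k]>)%VS; split=> [A|].
    split=> [/memv_addP[B /mem_limg_sact[a <-] [C /vlineP[y ->] ->]]|].
      by apply: End_GLD; [apply: End_GL_sact|apply/End_GLZ/End_GL_alt_third].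
    move=> /(End_GL_decomp char_k)[a [y ->]]; apply: memv_add.
      by apply/mem_limg_sact; exists a.
    by apply/vlineP; exists y.
  rewrite dimv_disjoint_sum ?(dim_limg_sact char_k) ?dim_vline ?alt_third_neq0 //.
  apply/eqP; rewrite -subv0; apply/subvP => A.
  rewrite memv_cap => /andP[/mem_limg_sact[a aA] /vlineP[y Ay]].
  have : sact 2 1 a + (- y) *: alt_third k = 0 by rewrite aA Ay scaleNr subrr.
  by move=> /(sact_alt_third_eq0 char_k)[/eqP]; rewrite oppr_eq0 Ay => /eqP -> _; rewrite scale0r mem0v.
- split; [exact: Phit_is_linear|exact: Phit_is_monoid_morphism|exact: Phit_inj|].
  exact: End_GL_Phit.
split.
  apply: raddf_inj => a a0.
  have aE : a = alt 5 (a 1%g).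
    by apply: sact_ker_alt a0 => x; apply: Zthird_mulrn_eq0.
  rewrite aE; move: a0; rewrite {1}aE /= sact_alt => /(congr1 (fun B => tentry B Jccccc Jccccc)).
  rewrite /tentry mxE -/(tentry _ _ _) alt_thirdE alt_thirdZ_Jccccc -(pmulrn 1 40) mxE.
  rewrite !mulr_natr -mulrnA => /Zthird_mulrn_eq0 -> //; exact: alt0.
move=> a; split=> [[A aA] S Sring SX|].
  have [b [z [-> _]]] := integral_action_decomp aA.
  have [S1 SB SM] := Sring.
  have S0 : 0 \in S by rewrite -(subrr 1) SB.
  have SN x : x \in S -> - x \in S by move=> xS; rewrite -sub0r SB.
  have SD x y : x \in S -> y \in S -> x + y \in S.
    by move=> xS yS; rewrite -[y]opprK SB // SN.
  have Sn x n : x \in S -> x *+ n \in S.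
    by move=> xS; elim: n => [|n IH]; rewrite ?mulr0n // mulrS SD.
  have Sz x w : x \in S -> x *~ w \in S.
    by move=> xS; case: w => n; rewrite ?NegzE ?mulrNz; [|apply: SN]; rewrite -pmulrn Sn.
  apply: (SD); last by apply/Sz/SX; right.
  have -> : [ffun g => (b g)%:~R] = \sum_g grp Zthird g *~ b g.
    apply/ffunP => g; rewrite ffunE sum_ffunE.
    have E s : (grp Zthird s *~ b s) g = (s == g)%:R * (b s)%:~R.
      rewrite mulrzr eq_sym; case: (b s) => n; rewrite ?NegzE ?mulrNz -?pmulrn.
        by rewrite ffunMnE ffunE.
      by rewrite ffunE ffunMnE ffunE.
    rewrite (eq_bigr _ (fun s _ => E s)) (bigD1 g) //= eqxx mul1r big1 ?addr0 //.
    by move=> s /negPf ->; rewrite mul0r.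
  by elim/big_ind: _ => [|x y|g _]; [exact: S0|exact: SD|apply/Sz/SX; left; exists g].
move=> /(_ (fun a => `[< exists A : SigmaZ 2 1 5,
    sact 2 1 a = base_change Zthird (SigmaZ_val A) >])) h.
apply/asboolP/h => {h}.
  split=> [|x y /asboolP[A xA] /asboolP[B yB]|x y /asboolP[A xA] /asboolP[B yB]]; apply/asboolP.
  - by exists 1; rewrite sact1; apply/esym/(rmorph1 (base_change _)).
  - by exists (A - B); rewrite raddfB /= xA yB -rmorphB.
  - by exists (A * B); rewrite rmorphM /= xA yB -rmorphM.
move=> y [[s ->]|->]; apply/asboolP.
  by exists (SigmaZ_perm s); rewrite sact_grp base_change_perm.
by exists SigmaZ_third; rewrite -/gen_third sact_gen_third.
Qed.
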